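(* Let $r=r(n)$ and $s=s(n)$ satisfy the inequality $(r-s)(n-1)\ge r(n-r)$ for all $n$. Let $p=p(n)=\omega\left(\frac{1}{\sqrt{\binom{n-r}{r-s}\binom{r}{s}}}\right)$. Then almost surely $$\limsup_{n\to\infty}q^*(G_p(n,r,s))\le\limsup_{n\to\infty}\frac{|sn-r^2|}{r(n-r)}.$$
   Context: For integers $n,r,s$, the Johnson graph $G(n,r,s)$ has as vertices all vectors $v\in\{0,1\}^n$ with exactly $r$ ones; two vertices are joined by an edge if and only if their inner product equals $s$. The parameters are assumed to be such that $G(n,r,s)$ is a graph with edges, $n>r>s\ge0$. For $p\in[0,1]$, $G_p(n,r,s)$ is the random graph obtained from $G(n,r,s)$ by removing every edge with probability $1-p$ independently of all other edges. The random graphs of the sequence are regarded as defined on a common probability space. Modularity: for a graph $G$ with $e(G)$ edges and a partition $\mathcal{A}$ of its vertex set, $q(\mathcal{A})=\sum_{A\in\mathcal{A}}\frac{e(A)}{e(G)}-\sum_{A\in\mathcal{A}}\frac{(\sum_{v\in A}\deg(v))^2}{4e(G)^2}$, where $e(A)$ is the number of edges of $G$ with both endpoints in $A$. The modularity of $G$ is $q^*(G)=\max_{\mathcal{A}}q(\mathcal{A})$, over all partitions of the vertex set. $f=\omega(g)$ means $f(n)/g(n)\to\infty$ as $n\to\infty$. *)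

(* Defs.v *)
From HB Require Import structures.
From mathcomp Require Import all_boot all_order all_algebra.
From mathcomp Require Import all_classical all_reals all_analysis.

Set Implicit Arguments.
Unset Strict Implicit.
Unset Printing Implicit Defensive.

Import Order.TTheory GRing.Theory Num.Theory.
Import numFieldNormedType.Exports.

Local Open Scope ring_scope.

(** A finite simple graph on [V] is given by its edge set [E : {set {set V}}],
    each edge being the two-element set of its endpoints. *)

Section Modularity.
Local Open Scope set_scope.
Variables (R : realType) (V : finType) (E : {set {set V}}).

Definition degree (v : V) : nat := #|[set e in E | v \in e]|.

Definition edges_inside (A : {set V}) : nat := #|[set e in E | e \subset A]|.

(** If [E] is empty, division by zero makes this score equal to [0]. *)
Definition partition_score (AA : {set {set V}}) : R :=
  (\sum_(A in AA) (edges_inside A)%:R / #|E|%:R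
   - \sum_(A in AA)
       (\sum_(v in A) degree v)%:R ^+ 2 / (4 * #|E|%:R ^+ 2))%R.

(** The base value of the iterated maximum is the score of the partition with
    one block, so (for nonempty [V]) this is the maximum over all partitions. *)
Definition modularity : R :=
  \big[Num.max/partition_score [set [set: V]]]_(AA : {set {set V}} |
     finset.partition AA [set: V]) partition_score AA.

End Modularity.

Definition johnson_vertex (n r : nat) : finType :=
  {v : {ffun 'I_n -> bool} | (\sum_(i < n) v i)%N == r}.

Definition inner_product (n r : nat) (v w : johnson_vertex n r) : nat :=
  (\sum_(i < n) val v i * val w i)%N.

Definition johnson_edges (n r s : nat) : {set {set johnson_vertex n r}} :=
  [set e | [exists v, exists w,
    [&& v != w, inner_product v w == s & e == [set v; w]]]]%SET.

Section Random_graph.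
Local Open Scope classical_set_scope.
Local Open Scope ereal_scope.
Variables (d : measure_display) (T : measurableType d) (R : realType).
Variable P : probability T R.

Definition mutually_independent (I : finType) (D : {set I}) (A : I -> set T) :=
  (forall i, i \in D -> measurable (A i)) /\
  forall J : {set I}, J \subset D ->
    P (\bigcap_(i in [set` J]) A i) = \prod_(i in J) P (A i).

Definition random_subgraph (V : finType) (E : {set {set V}}) (p : R)
    (G : T -> {set {set V}}) :=
  [/\ forall w, G w \subset E,
      forall e, e \in E -> P [set w | e \in G w] = p%:E
    & mutually_independent E (fun e => [set w | e \in G w])].

End Random_graph.

Definition little_omega (R : realType) (f g : nat -> R) : Prop :=
  ((fun n => f n / g n) @ \oo --> +oo)%classic.

(* Main.v *)
(** A partition score is a quadratic form in the adjacency matrix, so in a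
    regular graph it is controlled by the nontrivial eigenvalues.  Put a = r,
    b = n - r, t = r - s and k = C(a,t) C(b,t).  Every nontrivial eigenvalue of
    G(n,r,s) is at most k (|t/a + t/b - 1| + 16/n) in absolute value, where
    |t/a + t/b - 1| = |sn - r^2| / (r(n-r)): if x is a nonconstant common
    eigenvector of all distance relations of the Johnson scheme, then
    u |-> x(u + i) - x(u + j) is, for suitable points i and j, a common
    eigenvector on the scheme with parameters (a-1, b-1) whose eigenvalues are
    the partial sums of the old ones, so the bound follows by induction.

    For the random graph, merging the blocks of a partition at random into m
    classes multiplies its score by 1 - 1/m on average, so it suffices to
    control the edge counts inside all sets of vertices.  With N vertices there
    are 2^N of them, while each count deviates by a fixed proportion of the
    expected number pkN/2 of edges with probability exp(- c pkN) only; as pk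
    tends to infinity, a union bound and the Borel-Cantelli lemma conclude. *)

Require Import Defs.
From HB Require Import structures.
From mathcomp Require Import all_boot all_order perm all_algebra.
From mathcomp Require Import ring lra zify boolp.

Set Implicit Arguments.
Unset Strict Implicit.
Unset Printing Implicit Defensive.

Import Order.TTheory GRing.Theory Num.Theory.
Local Open Scope ring_scope.

(** * The eigenvalue bound *)

Definition johnson_degree (a b t : nat) : nat := 'C(a, t) * 'C(b, t).

Lemma johnson_degree_down a b t :
  (a.+1 * b.+1 * johnson_degree a b t =
   (a.+1 - t) * (b.+1 - t) * johnson_degree a.+1 b.+1 t)%N.
Proof.
rewrite /johnson_degree mulnACA (mul_bin_down a.+1) (mul_bin_down b.+1).
by rewrite mulnACA.
Qed.

Lemma johnson_degree_diag a b t :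
  (a.+1 * b.+1 * johnson_degree a b t =
   t.+1 * t.+1 * johnson_degree a.+1 b.+1 t.+1)%N.
Proof.
rewrite /johnson_degree mulnACA (mul_bin_diag a.+1) (mul_bin_diag b.+1).
by rewrite mulnACA.
Qed.

Section EigenvalueBound.
Variable F : realFieldType.

(* The main term is [|t/a + t/b - 1|], the first nontrivial eigenvalue divided
   by the degree; without the slack [16/(a+b)] the induction does not close
   when the first eigenvalue is close to [0]. *)
Definition eigen_bound (a b t : nat) : F :=
  `|t%:R * (a%:R + b%:R) - a%:R * b%:R| / (a%:R * b%:R) + 16 / (a%:R + b%:R).

Lemma eigen_bound_ge0 a b t : 0 <= eigen_bound a b t.
Proof. by rewrite addr_ge0 ?divr_ge0 ?mulr_ge0 ?addr_ge0. Qed.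

(* [D], [D + s - 1] and [D - 2 * t + 1] are the numerators of the main terms for
   the parameters [(a,b,t)], [(a-1,b-1,t)] and [(a-1,b-1,t-1)], with
   [A = a - t] and [B = b - t]. *)
Lemma eigen_bound_step_abs (A B t : F) : 1 <= A -> 1 <= B -> 1 <= t ->
  let s := A + B in let D := t ^+ 2 - A * B in
  let ab1 := (A + t - 1) * (B + t - 1) in
  (D + s - 1 <= 0 \/ 0 <= D - 2 * t + 1 ->
   A * B * `|D + s - 1| + t ^+ 2 * `|D - 2 * t + 1| <= `|D| * ab1) /\
  (0 <= D + s - 1 -> D - 2 * t + 1 <= 0 ->
   A * B * `|D + s - 1| + t ^+ 2 * `|D - 2 * t + 1| <=
    `|D| * ab1 + t ^+ 2 * (s + 2 * t - 2)).
Proof.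
move=> A1 B1 t1 s D ab1.
have ABs : 4 * (A * B) <= s ^+ 2.
  rewrite -subr_ge0; have -> : s ^+ 2 - 4 * (A * B) = (A - B) ^+ 2 by rewrite /s; ring.
  exact: sqr_ge0.
have ABs1 : 0 <= A * B - s + 1.
  have -> : A * B - s + 1 = (A - 1) * (B - 1) by rewrite /s; ring.
  by rewrite mulr_ge0 // subr_ge0.
have ab1E : ab1 = A * B + (t - 1) * s + (t - 1) ^+ 2 by rewrite /ab1 /s; ring.
have ABE : A * B = t ^+ 2 - D by rewrite /D; ring.
have s2 : 2 <= s by rewrite /s; lra.
have t20 : 0 <= (t - 1) * s by rewrite mulr_ge0 //; lra.
have t30 : 0 <= (t - 1) ^+ 2 by exact: sqr_ge0.
move: (A * B) ABs ABs1 ab1E ABE => P ABs ABs1 -> ABE.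
move: s D s2 t20 ABs ABs1 ABE => s D s2 t20 ABs ABs1 ABE.
split=> [[h|h]|h1 h2].
- have D0 : D <= 0 by lra.
  have D2 : D - 2 * t + 1 <= 0 by lra.
  rewrite (ler0_norm h) (ler0_norm D0) (ler0_norm D2).
  have h3 : 2 * P <= s * (P - t ^+ 2 + t).
    have : s * s <= s * (P - t ^+ 2 + t) by rewrite ler_wpM2l //; lra.
    lra.
  have h4 : 0 <= t * (s * (P - t ^+ 2 + t) - 2 * P).
    by rewrite mulr_ge0 //; lra.
  rewrite -subr_ge0; move: h4; congr (0 <= _); rewrite ABE; ring.
- have D0 : 0 <= D by lra.
  have D2 : 0 <= D + s - 1 by lra.
  rewrite (ger0_norm h) (ger0_norm D0) (ger0_norm D2).
  rewrite -subr_ge0.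
  have -> : D * (P + (t - 1) * s + (t - 1) ^+ 2) -
    (P * (D + s - 1) + t ^+ 2 * (D - 2 * t + 1)) =
    t * (s * (t ^+ 2 - t - P) + 2 * P) by rewrite ABE; ring.
  rewrite mulr_ge0 ?addr_ge0 ?mulr_ge0 //; lra.
(* With opposite signs the left-hand side does not shrink with [|D|]: at [D = 0] it equals the
   excess [t^2 (s + 2t - 2)] exactly. *)
- rewrite (ger0_norm h1) (ler0_norm h2).
  case/orP: (le_total 0 D) => D0.
    rewrite (ger0_norm D0) -subr_ge0.
    have -> : D * (P + (t - 1) * s + (t - 1) ^+ 2) + t ^+ 2 * (s + 2 * t - 2) -
      (P * (D + s - 1) + t ^+ 2 * - (D - 2 * t + 1)) =
      D * (P + (t - 1) * s + (t - 1) ^+ 2 + (s - 1 + D)) by rewrite ABE; ring.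
    by rewrite mulr_ge0 //; lra.
  rewrite (ler0_norm D0) -subr_ge0.
  have -> : - D * (P + (t - 1) * s + (t - 1) ^+ 2) + t ^+ 2 * (s + 2 * t - 2) -
      (P * (D + s - 1) + t ^+ 2 * - (D - 2 * t + 1)) =
     - D * ((P - s + 1) + (t - 1) * s + (t - 1) ^+ 2 - D) by rewrite ABE; ring.
  rewrite mulr_ge0 //; lra.
Qed.

(** This pays for the excess of the mixed-sign case. With weights, passing from slack [16/(n-2)] to
    [16/n] gains [16 (n t s - 2 ab) / (n (n-2))], which must cover [t^2 (n-2) / ab1]; clearing
    denominators gives the claim. The bounds on [P] say that the two numerators have opposite signs
    and are at least 1 in absolute value. *)
Lemma eigen_bound_step_slack (A B t : F) : 1 <= A -> 1 <= B -> 1 <= t ->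
  let s := A + B in let P := A * B in let n := s + 2 * t in
  let ab := P + t * s + t ^+ 2 in let ab1 := P + (t - 1) * s + (t - 1) ^+ 2 in
  (t - 1) ^+ 2 + 1 <= P -> P <= t ^+ 2 + s - 2 -> 2 * t - 1 <= s -> 16 <= n ->
  t ^+ 2 * n * (n - 2) ^+ 2 <= 16 * ab1 * (n * t * s - 2 * ab).
Proof.
move=> A1 B1 t1 s P n ab ab1 P1 P2 st n16.
have Ps1 : 0 <= P - s + 1.
  have -> : P - s + 1 = (A - 1) * (B - 1) by rewrite /s /P; ring.
  by rewrite mulr_ge0 // subr_ge0.
have s2 : 2 <= s by rewrite /s; lra.
move: s P s2 Ps1 @n @ab @ab1 P1 P2 st n16 => s P s2 Ps1 n ab ab1 P1 P2 st n16.
have s7 : 15 <= 2 * s by move: n16; rewrite /n; lra.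
have h1 : t * (n - 2) <= 2 * ab1.
  have h : 0 <= t * (s - 2) by rewrite mulr_ge0 //; lra.
  rewrite /ab1 /n -subr_ge0.
  have -> : 2 * (P + (t - 1) * s + (t - 1) ^+ 2) - t * (s + 2 * t - 2) =
    2 * (P - s + 1) + t * (s - 2) by ring.
  lra.
have h2 : t * s * n <= 2 * (n * t * s - 2 * ab).
  have h : 0 <= (t * s) * (s - 15 / 2) by rewrite !mulr_ge0 //; lra.
  have h' : 0 <= (t - 1) * s by rewrite !mulr_ge0 //; lra.
  have h'' : 0 <= (t ^+ 2 - 1) * (s - 4) by rewrite !mulr_ge0 ?subr_ge0 ?expr_ge1 //; lra.
  rewrite /ab /n; lra.
have h3 : n - 2 <= 2 * s by rewrite /n; lra.
have n0 : 0 <= n - 2 by lra.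
have h4 : (t * (n - 2)) * (t * s * n) <= (2 * ab1) * (2 * (n * t * s - 2 * ab)).
  by rewrite ler_pM // !mulr_ge0 //; lra.
have h5 : 0 <= (t ^+ 2 * n * (n - 2)) * (2 * s - (n - 2)).
  by rewrite !mulr_ge0 ?sqr_ge0 //; lra.
have h6 : 0 <= t ^+ 2 * n * (n - 2) * s by rewrite !mulr_ge0 ?sqr_ge0 //; lra.
lra.
Qed.

(** This is the induction step divided by [k / ab], where [k] is the new degree: the two smaller
    degrees are [k x y / ab] and [k z^2 / ab], with [x = a - t], [y = b - t], [z = t]. *)
Lemma eigen_bound_step_real (x y z : F) : 1 <= x -> 1 <= y -> 1 <= z ->
  let s := x + y in let D := z ^+ 2 - x * y in
  let ab := (x + z) * (y + z) in let ab1 := (x + z - 1) * (y + z - 1) in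
  16 <= s + 2 * z ->
  [\/ D + s - 1 <= 0, 0 <= D - 2 * z + 1
    | [/\ 1 <= D + s - 1, D - 2 * z + 1 <= -1 & 2 * z - 1 <= s]] ->
  x * y * (`|D + s - 1| / ab1 + 16 / (s + 2 * z - 2)) +
  z ^+ 2 * (`|D - 2 * z + 1| / ab1 + 16 / (s + 2 * z - 2)) <=
  ab * (`|D| / ab + 16 / (s + 2 * z)).
Proof.
move=> x1 y1 z1 s D ab ab1 n16 tri.
have [st1 st2] := eigen_bound_step_abs x1 y1 z1.
have slack : (z - 1) ^+ 2 + 1 <= x * y -> x * y <= z ^+ 2 + s - 2 ->
    2 * z - 1 <= s -> z ^+ 2 * (s + 2 * z) * (s + 2 * z - 2) ^+ 2 <=
    16 * ab1 * ((s + 2 * z) * z * s - 2 * ab).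
  move=> *; have -> : ab1 = x * y + (z - 1) * s + (z - 1) ^+ 2 by rewrite /ab1 /s; ring.
  have -> : ab = x * y + z * s + z ^+ 2 by rewrite /ab /s; ring.
  exact: eigen_bound_step_slack.
have s2 : 2 <= s by rewrite /s; lra.
have abE : ab = x * y + z * s + z ^+ 2 by rewrite /ab /s; ring.
have ab0 : 0 < ab by rewrite mulr_gt0 //; lra.
have ab10 : 0 < ab1 by rewrite mulr_gt0 //; lra.
have h4 : 0 <= s ^+ 2 - 4 * (x * y).
  have -> : s ^+ 2 - 4 * (x * y) = (x - y) ^+ 2 by rewrite /s; ring.
  exact: sqr_ge0.
move: st1 st2 tri slack abE h4; rewrite -/s -/D -/ab1.
have -> : x * y = z ^+ 2 - D by rewrite /D; ring.
move: s D ab ab1 s2 ab0 ab10 n16.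
clear x y x1 y1 => s D ab ab1 s2 ab0 ab10 n16 st1 st2 tri slack abE h4.
have n0 : 0 < s + 2 * z by lra.
have n20 : 0 < s + 2 * z - 2 by lra.
have -> u v : (z ^+ 2 - D) * (u / ab1 + 16 / (s + 2 * z - 2)) +
   z ^+ 2 * (v / ab1 + 16 / (s + 2 * z - 2)) =
   ((z ^+ 2 - D) * u + z ^+ 2 * v) / ab1 +
   16 * (z ^+ 2 - D + z ^+ 2) / (s + 2 * z - 2) by ring.
rewrite [ab * (_ + _)]mulrDr mulrCA divff ?gt_eqF // mulr1.
(* Without an excess, main terms and slack terms can be compared separately. *)
have short : D + s - 1 <= 0 \/ 0 <= D - 2 * z + 1 ->
  ((z ^+ 2 - D) * `|D + s - 1| + z ^+ 2 * `|D - 2 * z + 1|) / ab1 +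
  16 * (z ^+ 2 - D + z ^+ 2) / (s + 2 * z - 2) <= `|D| + ab * (16 / (s + 2 * z)).
  move=> h; apply: lerD; first by rewrite ler_pdivrMr // st1.
  rewrite mulrA ler_pdivrMr // mulrAC ler_pdivlMr // -subr_ge0.
  have -> : ab * 16 * (s + 2 * z - 2) - 16 * (z ^+ 2 - D + z ^+ 2) * (s + 2 * z) =
    16 * ((s ^+ 2 - 4 * (z ^+ 2 - D)) / 2 + (z - 1 / 2) * (s ^+ 2 - 4)
        + 2 * (z * (z - 1)) * (s - 2) + 2 * (z ^+ 2 - 1)) by rewrite abE; field.
  have z21 : 1 <= z ^+ 2 by rewrite expr_ge1 //; lra.
  have s24 : 0 <= s ^+ 2 - 4.
    have -> : s ^+ 2 - 4 = (s - 2) * (s + 2) by ring.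
    by rewrite mulr_ge0 //; lra.
  rewrite mulr_ge0 // addr_ge0 ?mulr_ge0 //; [|lra].
  by rewrite !addr_ge0 ?mulr_ge0 ?divr_ge0 //; lra.
case: tri => [h|h|[h1 h2 h3]]; [by apply: short; left|by apply: short; right|].
have h : ((z ^+ 2 - D) * `|D + s - 1| + z ^+ 2 * `|D - 2 * z + 1|) / ab1 <=
    `|D| + z ^+ 2 * (s + 2 * z - 2) / ab1.
  rewrite ler_pdivrMr // [X in _ <= X]mulrDl divfK ?gt_eqF // st2 //; lra.
rewrite -(lerD2r (16 * (z ^+ 2 - D + z ^+ 2) / (s + 2 * z - 2))) in h.
apply: (le_trans h); rewrite -addrA lerD2l.
rewrite mulrA [X in X <= _]addf_div ?gt_eqF // ler_pdivrMr ?mulr_gt0 //.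
rewrite [X in _ <= X]mulrAC ler_pdivlMr // -subr_ge0.
have : 0 <= 16 * ab1 * ((s + 2 * z) * z * s - 2 * ab) -
    z ^+ 2 * (s + 2 * z) * (s + 2 * z - 2) ^+ 2.
  by rewrite subr_ge0 slack //; lra.
congr (0 <= _); rewrite abE; ring.
Qed.

Lemma eigen_bound_step a b t : (t < a)%N -> (t < b)%N -> (14 <= a + b)%N ->
  (johnson_degree a b t.+1)%:R * eigen_bound a b t.+1 +
  (johnson_degree a b t)%:R * eigen_bound a b t <=
  (johnson_degree a.+1 b.+1 t.+1)%:R * eigen_bound a.+1 b.+1 t.+1.
Proof.
move=> ta tb n14.
have a0 : (0 < a)%N by lia.
have b0 : (0 < b)%N by lia.
have [A A1 aE] : exists2 A, (1 <= A)%N & a = (A + t)%N by exists (a - t)%N; lia.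
have [B B1 bE] : exists2 B, (1 <= B)%N & b = (B + t)%N by exists (b - t)%N; lia.
pose x : F := A%:R; pose y : F := B%:R; pose z : F := t.+1%:R.
have x1 : 1 <= x by rewrite ler1n.
have y1 : 1 <= y by rewrite ler1n.
have z1 : 1 <= z by rewrite ler1n.
have aR : a%:R = x + z - 1 :> F by rewrite aE natrD /z -natr1 /x; ring.
have bR : b%:R = y + z - 1 :> F by rewrite bE natrD /z -natr1 /y; ring.
have a1R : a.+1%:R = x + z :> F by rewrite -natr1 aR; ring.
have b1R : b.+1%:R = y + z :> F by rewrite -natr1 bR; ring.
have tR : t%:R = z - 1 :> F by rewrite /z -natr1; ring.
have a0R : 0 < x + z - 1 by rewrite -aR ltr0n.
have b0R : 0 < y + z - 1 by rewrite -bR ltr0n.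
pose K : F := (johnson_degree a.+1 b.+1 t.+1)%:R.
have ab_neq0 : (x + z) * (y + z) != 0.
  by rewrite -a1R -b1R mulf_neq0 // pnatr_eq0.
have E1 : (johnson_degree a b t.+1)%:R = K * (x * y) / ((x + z) * (y + z)).
  apply: (mulIf ab_neq0); rewrite divfK // -a1R -b1R.
  have eqA : (a.+1 - t.+1 = A)%N by lia.
  have eqB : (b.+1 - t.+1 = B)%N by lia.
  rewrite /K /x /y -!natrM; congr _%:R.
  by rewrite mulnC johnson_degree_down eqA eqB mulnC.
have E2 : (johnson_degree a b t)%:R = K * z ^+ 2 / ((x + z) * (y + z)).
  apply: (mulIf ab_neq0); rewrite divfK // -a1R -b1R.
  rewrite /K /z -natrX -!natrM; congr _%:R.
  by rewrite mulnC johnson_degree_diag mulnC.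
rewrite E1 E2 -/K /eigen_bound a1R b1R aR bR -/z tR.
have K0 : 0 <= K by [].
pose D := z ^+ 2 - x * y; pose s := x + y.
have -> : z * (x + z - 1 + (y + z - 1)) - (x + z - 1) * (y + z - 1) = D + s - 1.
  by rewrite /D /s; ring.
have -> : (z - 1) * (x + z - 1 + (y + z - 1)) - (x + z - 1) * (y + z - 1) =
   D - 2 * z + 1 by rewrite /D /s; ring.
have -> : z * (x + z + (y + z)) - (x + z) * (y + z) = D by rewrite /D; ring.
have -> : x + z - 1 + (y + z - 1) = s + 2 * z - 2 by rewrite /s; ring.
have -> : x + z + (y + z) = s + 2 * z by rewrite /s; ring.
pose ab1 := (x + z - 1) * (y + z - 1); rewrite -/ab1.
pose ab := (x + z) * (y + z).
have ab10 : 0 < ab1 by rewrite mulr_gt0.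
have ab0 : 0 < ab by rewrite mulr_gt0 //; lra.
have n16 : 16 <= s + 2 * z.
  have -> : s + 2 * z = (a + b + 2)%:R by rewrite !natrD aR bR /s; ring.
  by rewrite ler_nat; lia.
suff H : x * y * (`|D + s - 1| / ab1 + 16 / (s + 2 * z - 2)) +
   z ^+ 2 * (`|D - 2 * z + 1| / ab1 + 16 / (s + 2 * z - 2)) <=
   ab * (`|D| / ab + 16 / (s + 2 * z)).
  rewrite -/ab; set u := _ + _ / (s + 2 * z - 2) in H *.
  set v := _ + _ / (s + 2 * z - 2) in H *; set w := _ + _ / (s + 2 * z) in H *.
  have -> : K * (x * y) / ab * u + K * z ^+ 2 / ab * v =
    K / ab * (x * y * u + z ^+ 2 * v) by ring.
  have -> : K * w = K / ab * (ab * w) by rewrite mulrA divfK // gt_eqF.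
  by rewrite ler_wpM2l // divr_ge0 // ltW.
(* Both numerators are integers, [(t+1)^2 - (A-1)(B-1)] and [t^2 - A B], so a nonzero one is at
   least 1 in absolute value. The last bound comes from [t^2 < A B <= ((A+B)/2)^2]. *)
have tri : [\/ D + s - 1 <= 0, 0 <= D - 2 * z + 1
    | [/\ 1 <= D + s - 1, D - 2 * z + 1 <= -1 & 2 * z - 1 <= s]].
  have eq1 : D + s - 1 = (t.+1 ^ 2)%:R - ((A.-1) * (B.-1))%:R :> F.
    rewrite natrM -!subn1 !natrB // natrX -/x -/y -/z /D /s; ring.
  have eq2 : D - 2 * z + 1 = (t ^ 2)%:R - (A * B)%:R :> F.
    rewrite natrM natrX tR -/x -/y /D; ring.
  have [h|h] := leqP (t.+1 ^ 2) (A.-1 * B.-1).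
    by constructor 1; rewrite eq1 subr_le0 ler_nat.
  have [h'|h'] := leqP (A * B) (t ^ 2).
    by constructor 2; rewrite eq2 subr_ge0 ler_nat.
  constructor 3; split.
  - by move: h; rewrite eq1 -(ler_nat F) -natr1; lra.
  - by move: h'; rewrite eq2 -(ler_nat F) -natr1; lra.
  - have : (2 * t + 1 <= A + B)%N.
      rewrite addn1 ltnNge; apply/negP => h2.
      have h3 : ((A + B) ^ 2 <= (2 * t) ^ 2)%N by rewrite leq_sqr.
      have := leq_trans (nat_AGM2 A B) h3.
      by rewrite expnMn leq_pmul2l // leqNgt h'.
    rewrite addn1 -(ler_nat F) -natr1 natrM natrD tR -/x -/y /s; lra.
exact: eigen_bound_step_real.
Qed.

Lemma johnson_degree_pascal a b t :
  (johnson_degree a b t.+1 + johnson_degree a b t <=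
   johnson_degree a.+1 b.+1 t.+1)%N.
Proof. by rewrite /johnson_degree !binS; nia. Qed.

(** For few points the slack alone reaches 1, so the trivial bound by the degree suffices there. *)
Lemma eigen_bound_small a b t : (0 < a + b <= 16)%N -> 1 <= eigen_bound a b t.
Proof.
move=> /andP[n0 n16]; rewrite /eigen_bound -natrD.
rewrite -[X in X <= _]add0r lerD ?divr_ge0 ?mulr_ge0 //.
by rewrite ler_pdivlMr ?ltr0n // mul1r ler_nat.
Qed.

Lemma eigen_bound0 a b : (0 < a)%N -> (0 < b)%N -> 1 <= eigen_bound a b 0.
Proof.
move=> a0 b0; rewrite /eigen_bound mul0r sub0r normrN ger0_norm ?mulr_ge0 //.
by rewrite divff ?mulf_neq0 ?pnatr_eq0 -?lt0n // lerDl divr_ge0 // -natrD.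
Qed.

(** This difference of degrees is the eigenvalue that arises from a constant difference vector. Up
    to sign it is the degree times the main term, as [(a-t)(b-t) - (t+1)^2 = (a+1)(b+1) -
    (t+1)(a+b+2)]. *)
Lemma eigen_bound_linear a b t :
  `|(johnson_degree a b t.+1)%:R - (johnson_degree a b t)%:R| <=
  (johnson_degree a.+1 b.+1 t.+1)%:R * eigen_bound a.+1 b.+1 t.+1.
Proof.
have [ta|ta] := leqP t a; last first.
  rewrite /johnson_degree !(@bin_small a) //; last exact: ltnW.
  by rewrite !mul0n subrr normr0 mulr_ge0 ?eigen_bound_ge0.
have [tb|tb] := leqP t b; last first.
  rewrite /johnson_degree !(@bin_small b) //; last exact: ltnW.
  by rewrite !muln0 subrr normr0 mulr_ge0 ?eigen_bound_ge0.
set K := johnson_degree a.+1 b.+1 t.+1.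
pose q : F := a.+1%:R * b.+1%:R.
have q0 : 0 < q by rewrite mulr_gt0.
have E1 := johnson_degree_down a b t.+1.
have E2 := johnson_degree_diag a b t.
rewrite -/K !subSS in E1 E2.
rewrite /eigen_bound mulrDr -[X in X <= _]addr0 lerD //; last first.
  by rewrite mulr_ge0 // divr_ge0 // addr_ge0.
rewrite mulrA ler_pdivlMr // -/q; move: K E1 E2 => K E1 E2.
have -> (x : F) : `|x| * q = `|x * q| by rewrite normrM (ger0_norm (ltW q0)).
have -> (x : F) : K%:R * `|x| = `|K%:R * x| by rewrite normrM ger0_norm.
rewrite mulrBl /q -!natrM ![(johnson_degree _ _ _ * _)%N]mulnC E1 E2.
rewrite !natrM !natrB // -!natr1 distrC.
by rewrite le_eqVlt; apply/orP; left; apply/eqP; congr `|_|; ring.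
Qed.

(** The degree at [t+1] vanishes here, so the sum is the absolute difference of
    [eigen_bound_linear]. *)
Lemma eigen_bound_boundary a b t : (a <= t)%N || (b <= t)%N ->
  (johnson_degree a b t.+1 + johnson_degree a b t)%:R <=
  (johnson_degree a.+1 b.+1 t.+1)%:R * eigen_bound a.+1 b.+1 t.+1.
Proof.
move=> h; have K0 : johnson_degree a b t.+1 = 0%N.
  by case/orP: h => h; rewrite /johnson_degree;
    [rewrite (@bin_small a) | rewrite (@bin_small b) // muln0].
by rewrite (le_trans _ (eigen_bound_linear a b t)) // K0 sub0r normrN ger0_norm // add0n.
Qed.

End EigenvalueBound.

(** * Layers of a finite set and their distance relations *)

Section Layers.
Variable I : finType.
Implicit Types (X u v w : {set I}) (i j : I).

(** The ground set [X] varies because the induction deletes two points from it. The distance of two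
    members is [#|v :\: w|]. *)
Definition layer X (a : nat) : {set {set I}} :=
  [set v : {set I} | (v \subset X) && (#|v| == a)].

(** A set [w] is determined by the [t] points of [v] that it omits and the [t] points of [X :\: v]
    that it adds, and both choices are free. *)
Lemma card_layer_dist X v a b t : #|X| = (a + b)%N -> v \in layer X a ->
  #|[set w in layer X a | #|v :\: w| == t]| = johnson_degree a b t.
Proof.
move=> Xab; rewrite inE => /andP[vX /eqP va].
pose f (AB : {set I} * {set I}) := (v :\: AB.1) :|: AB.2.
pose D := setX [set A : {set I} | A \subset v & #|A| == t]
               [set B : {set I} | B \subset X :\: v & #|B| == t].
have fK1 AB : AB \in D -> v :\: f AB = AB.1.
  case: AB => A B; rewrite !inE /= => /andP[/andP[Av _] /andP[BX _]].
  apply/setP => k; rewrite !inE.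
  case kA : (k \in A).
    rewrite (subsetP Av) // andbT; apply/negP => /(subsetP BX).
    by rewrite inE (subsetP Av).
  by rewrite /= negb_or; case: (k \in v); rewrite ?andbF.
have fK2 AB : AB \in D -> f AB :\: v = AB.2.
  case: AB => A B; rewrite !inE /= => /andP[/andP[Av _] /andP[BX _]].
  apply/setP => k; rewrite !inE /=.
  case kB : (k \in B); first by move/(subsetP BX): kB; rewrite inE => /andP[-> _]; rewrite orbT.
  by case: (k \in v); rewrite ?andbF.
have <- : #|f @: D| = johnson_degree a b t.
  rewrite card_in_imset; last first.
    by move=> p q pD qD e; rewrite [p]surjective_pairing [q]surjective_pairing
      -(fK1 p) // -(fK1 q) // -(fK2 p) // -(fK2 q) // e.
  rewrite cardsX !cards_draws va cardsD (setIidPr vX) Xab va.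
  by rewrite addKn.
apply: eq_card => w; apply/idP/imsetP => [|[AB ABD ->]].
  rewrite !inE => /andP[/andP[wX /eqP wa] /eqP vw].
  exists (v :\: w, w :\: v).
    rewrite !inE /= subsetDl vw eqxx setSD //=.
    by rewrite cardsD wa setIC -[X in (X - _)%N]va -cardsD vw.
  apply/setP => k; rewrite !inE /=.
  by case: (k \in v); case: (k \in w).
have e1 := fK1 _ ABD; have e2 := fK2 _ ABD.
move: (ABD); case: AB ABD e1 e2 => A B ABD /= e1 e2.
rewrite !inE /= e1 => /andP[/andP[Av /eqP At] /andP[BX /eqP Bt]].
rewrite At eqxx andbT; apply/andP; split.
  rewrite subUset (subset_trans (subsetDl _ _) vX) /=.
  exact: subset_trans BX (subsetDl _ _).
have := cardsID v (f (A, B)); rewrite e2 Bt => <-.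
by have := cardsID (f (A, B)) v; rewrite e1 va At setIC => <-.
Qed.

Lemma cardU1D i u w : i \notin u ->
  #|(i |: u) :\: w| = (#|u :\: w| + (i \notin w))%N.
Proof.
move=> iu; rewrite setDUl; case iw : (i \in w) => /=.
  by rewrite addn0 (_ : [set i] :\: w = set0) ?set0U //;
     apply/eqP; rewrite setD_eq0 sub1set.
rewrite (_ : [set i] :\: w = [set i]).
  by rewrite cardsU1 inE (negbTE iu) andbF addnC.
by apply/setDidPl; rewrite disjoints1 iw.
Qed.

Lemma card_setDU1 i u w : i \notin u -> u :\: (i |: w) = u :\: w.
Proof.
move=> iu; apply/setP => k; rewrite !inE negb_or -andbA.
by case: eqP => // ->; rewrite (negbTE iu) andbF.
Qed.

End Layers.

(** * Common eigenvectors of the distance relations *)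

Section LayerEigen.
Variables (I : finType) (F : numFieldType).
Implicit Types (X u v w : {set I}) (i j : I) (x : {set I} -> F) (la : nat -> F).

Definition layer_eigen X a x la := forall t v, v \in layer X a ->
  \sum_(w in layer X a | #|v :\: w| == t) x w = la t * x v.

Lemma in_layerU1 X a i j u : i \in X -> j \in X -> i != j ->
  [&& (i |: u) \in layer X a.+1, i \in i |: u, j \notin i |: u
    & ((i |: u) :\ i == u)] = (u \in layer (X :\ i :\ j) a).
Proof.
move=> iX jX ij; have [iu|iu] := boolP (i \in u).
  have -> : ((i |: u) :\ i == u) = false.
    by apply/negP => /eqP/setP/(_ i); rewrite !inE eqxx iu.
  rewrite !andbF inE; apply/esym/negP => /andP[/subsetP/(_ i iu)].
  by rewrite !inE eqxx andbF.
rewrite !inE eqxx /= setU1K // eqxx andbT subUset sub1set iX /= cardsU1 iu eqSS.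
rewrite negb_or (eq_sym j) ij /= !subsetD1 iu andbT.
by rewrite -!andbA; congr (_ && _); rewrite andbC.
Qed.

Lemma sum_layerU1 X a i j (h : {set I} -> F) : i \in X -> j \in X -> i != j ->
  \sum_(w in layer X a.+1 | (i \in w) && (j \notin w)) h w =
  \sum_(u in layer (X :\ i :\ j) a) h (i |: u).
Proof.
move=> iX jX ij.
rewrite (reindex_onto (fun u => i |: u) (fun w => w :\ i)) /=; last first.
  by move=> w /and3P[_ iw _]; rewrite setD1K.
by apply: eq_bigl => u; rewrite -(in_layerU1 a u iX jX ij) -!andbA.
Qed.

Lemma sum_layer_split X a i j (h : {set I} -> F) :
    i \in X -> j \in X -> i != j ->
    (forall w, (i \in w) = (j \in w) -> h w = 0) ->
  \sum_(w in layer X a.+1) h w =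
  \sum_(u in layer (X :\ i :\ j) a) (h (i |: u) + h (j |: u)).
Proof.
move=> iX jX ij h0; rewrite big_split /= -(sum_layerU1 a h iX jX ij).
have -> : X :\ i :\ j = X :\ j :\ i by rewrite !setDDl setUC.
rewrite -(sum_layerU1 a h jX iX) 1?eq_sym //.
rewrite (bigID (fun w => (i \in w) == (j \in w))) /= big1 ?add0r; last first.
  by move=> w /andP[_ /eqP /h0].
rewrite (bigID (fun w => i \in w)) /=; congr (_ + _);
  by apply: eq_bigl => w; rewrite -andbA; congr (_ && _);
     case: (i \in w); case: (j \in w).
Qed.

(** Subtract the eigenvector equations at [i |: u] and [j |: u]. Sets containing both or neither of
    [i], [j] cancel, while [i |: u'] is at distance [#|u :\: u'|] from [i |: u] and one more from
    [j |: u]. Hence [la t] times the difference vector is [S t - S (t-1)], and the sum over [t]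
    telescopes. *)
Lemma layer_eigen_swap X a x la i j :
    i \in X -> j \in X -> i != j -> layer_eigen X a.+1 x la ->
  layer_eigen (X :\ i :\ j) a (fun u => x (i |: u) - x (j |: u))
    (fun t => \sum_(s < t.+1) la s).
Proof.
move=> iX jX ij ex; pose g u := x (i |: u) - x (j |: u).
set X' := X :\ i :\ j.
pose S t u := \sum_(u' in layer X' a | #|u :\: u'| == t) g u'.
have ij' : j != i by rewrite eq_sym.
have inu u : u \in layer X' a -> (i \notin u) && (j \notin u).
  rewrite inE => /andP[/subsetP uX _]; apply/andP; split; apply/negP => /uX;
  by rewrite !inE eqxx ?andbF.
have lu u : u \in layer X' a -> i |: u \in layer X a.+1.
  by rewrite -(in_layerU1 a u iX jX ij) => /andP[].
have lu' u : u \in layer X' a -> j |: u \in layer X a.+1.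
  by rewrite /X' setDDl setUC -setDDl -(in_layerU1 a u jX iX ij') => /andP[].
have key t u : u \in layer X' a ->
    la t * g u = S t u - (if t is t'.+1 then S t' u else 0).
  move=> uX; have /andP[iu ju] := inu _ uX.
  rewrite mulrBr -(ex t _ (lu _ uX)) -(ex t _ (lu' _ uX)).
  rewrite ![\sum_(w in _ | _ == t) x _]big_mkcondr -sumrB.
  rewrite (@sum_layer_split X a i j) //; last first.
    by move=> w eij; rewrite !cardU1D // eij subrr.
  have -> : S t u - (if t is t'.+1 then S t' u else 0) =
     \sum_(u' in layer X' a) ((#|u :\: u'| == t)%:R * g u' -
        (#|u :\: u'|.+1 == t)%:R * g u').
    rewrite sumrB; congr (_ - _).
      by rewrite /S big_mkcondr; apply: eq_bigr => w _; case: eqP; rewrite ?mul1r ?mul0r.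
    case: t => [|t]; first by rewrite big1 // => w _; rewrite mul0r.
    by rewrite /S big_mkcondr; apply: eq_bigr => w _; rewrite eqSS; case: eqP; rewrite ?mul1r ?mul0r.
  apply: eq_bigr => w wX; have /andP[iw jw] := inu _ wX.
  rewrite !cardU1D // !card_setDU1 // !inE !eqxx /= (negbTE iw) (negbTE jw).
  rewrite (negbTE ij) (negbTE ij') /= !addn0 !addn1 /g.
  by case: (_ == t); case: (_ == t); rewrite /=; ring.
move=> t u uX; rewrite -/(g u) -/(S t u).
elim: t => [|t IH]; first by rewrite big_ord1 key // subr0.
by rewrite big_ord_recr /= mulrDl -IH key // addrC subrK.
Qed.

Lemma layer_eigen_const X a b x la c : #|X| = (a + b)%N -> c != 0 ->
  (forall v, v \in layer X a -> x v = c) -> layer X a != set0 ->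
  layer_eigen X a x la -> forall t, la t = (johnson_degree a b t)%:R.
Proof.
move=> Xab c0 xc /set0Pn[v vX] ex t; apply: (mulIf c0).
rewrite -{1}(xc v vX) -ex // -(card_layer_dist t Xab vX) -sum1_card natr_sum.
rewrite mulr_suml; apply: eq_big => w; rewrite ?inE // => /andP[wX _].
by rewrite mul1r xc // inE.
Qed.

(** Two members of a layer are joined by exchanging one point at a time, each exchange lowering
    [#|v :\: w|]. Contrapositively, a nonconstant [x] has a nonzero difference vector. *)
Lemma layer_connected X a x :
  (forall u i j, i \in X -> j \in X -> i != j ->
     u \in layer (X :\ i :\ j) a -> x (i |: u) = x (j |: u)) ->
  {in layer X a.+1 &, forall v w, x v = x w}.
Proof.
move=> H v w vX wX; move d : #|v :\: w| => n.
elim: n v vX d => [|n IH] v vX d.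
  move: vX wX; rewrite !inE => /andP[vX /eqP va] /andP[wX /eqP wa].
  congr (x _); apply/eqP; rewrite eqEcard va wa leqnn andbT.
  by rewrite -setD_eq0 -cards_eq0 d.
have /card_gt0P[i] : (0 < #|v :\: w|)%N by rewrite d.
rewrite inE => /andP[iw iv].
have /card_gt0P[j] : (0 < #|w :\: v|)%N.
  move: vX wX; rewrite !inE => /andP[vX /eqP va] /andP[wX /eqP wa].
  by have := cardsID v w; have := cardsID w v; rewrite setIC d; lia.
rewrite inE => /andP[jv jw].
have ij : i != j by apply: contraNneq iw => ->.
have sX u : u \in layer X a.+1 -> u \subset X by rewrite inE => /andP[].
have iX := subsetP (sX _ vX) _ iv; have jX := subsetP (sX _ wX) _ jw.
have uX : v :\ i \in layer (X :\ i :\ j) a.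
  rewrite -(in_layerU1 a _ iX jX ij) setD1K // vX iv jv eqxx //.
rewrite -(setD1K iv) (H _ i j) //.
have ij' : j != i by rewrite eq_sym.
have uX' : v :\ i \in layer (X :\ j :\ i) a.
  by rewrite setDDl setUC -setDDl.
apply: IH; first by move: uX'; rewrite -(in_layerU1 a _ jX iX ij') => /andP[].
rewrite cardU1D ?jw ?addn0; last by rewrite inE (negbTE jv) andbF.
by rewrite setDDl setUC -setDDl; have := cardsD1 i (v :\: w); rewrite d inE iw iv => -[].
Qed.

End LayerEigen.

(** * The induction for the eigenvalue bound *)

Section LayerEigenBound.
Variables (I : finType) (F : numFieldType).
Implicit Types (X u v w : {set I}) (i j : I) (x : {set I} -> F) (la : nat -> F).

Definition constant_on (D : {set {set I}}) x :=
  [forall v in D, forall w in D, x v == x w].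

Lemma constant_onP (D : {set {set I}}) x :
  reflect {in D &, forall v w, x v = x w} (constant_on D x).
Proof.
apply: (iffP forall_inP) => H v; first by move=> w vD wD; apply/eqP; exact: (forall_inP (H v vD)).
by move=> vD; apply/forall_inP => w wD; apply/eqP; exact: H.
Qed.

(** Induction on [a] by [layer_eigen_swap]. The trivial bound is carried along because it settles
    small parameters and the boundary. The sharp bound is computed over [rat] and mapped by [ratr],
    since [F] need not be totally ordered. *)
Theorem layer_eigen_bound a b X x la : #|X| = (a + b)%N ->
    layer_eigen X a x la -> (exists2 v, v \in layer X a & x v != 0) ->
  forall t, `|la t| <= (johnson_degree a b t)%:R /\
    (~~ constant_on (layer X a) x ->
     `|la t| <= (johnson_degree a b t)%:R * ratr (eigen_bound rat a b t)).
Proof.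
elim: a b X x la => [|a IH] b X x la Xab ex [v vX xv0] t.
all: have [/constant_onP xc|xnc] := boolP (constant_on (layer X _) x).
1,3: split=> //; rewrite (@layer_eigen_const _ _ X _ b x la (x v) _ _ _ _ ex) ?normr_nat //;
  [by move=> w wX; exact: xc | by apply/set0Pn; exists v].
  case/constant_onP: xnc => y z; rewrite !inE => /andP[_ /eqP v0] /andP[_ /eqP w0].
  by rewrite (cards0_eq v0) (cards0_eq w0).
have [u [i [j [iX jX ij uX xij]]]] : exists u i j,
    [/\ i \in X, j \in X, i != j, u \in layer (X :\ i :\ j) a & x (i |: u) != x (j |: u)].
  apply: contrapT => H; case/constant_onP: xnc; apply: layer_connected => u i j iX jX ij uX.
  by apply/eqP; apply: contrapT => /negP xij; apply: H; exists u, i, j.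
have ij' : j != i by rewrite eq_sym.
have [b' Xab'] : exists2 b', b = b'.+1 & #|X :\ i :\ j| = (a + b')%N.
  have /subset_leq_card : u \subset X :\ i :\ j by move: uX; rewrite inE => /andP[].
  have /eqP -> : #|u| == a by move: uX; rewrite inE => /andP[].
  have := cardsD1 j (X :\ i); have := cardsD1 i X.
  rewrite iX !inE jX ij' Xab /= => eX eXi h.
  clear -eX eXi h; case: b eX => [|b'] eX; first by lia.
  by exists b' => //; lia.
subst b => Xab'.
have ex' := layer_eigen_swap iX jX ij ex.
set g := (fun u => x (i |: u) - x (j |: u)) in ex'.
set la' := (fun t : nat => _) in ex'.
have gu : exists2 v, v \in layer (X :\ i :\ j) a & g v != 0.
  by exists u => //; rewrite subr_eq0.
have natF n : n%:R = ratr n%:R :> F by rewrite ratr_nat.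
have bnd := IH _ _ _ _ Xab' ex' gu.
case: t => [|t].
  have := (bnd 0%N).1; rewrite /la' big_ord1 /johnson_degree !bin0 muln1 => h.
  split=> // _; rewrite (le_trans h) // mul1r -(rmorph1 (@ratr F)) ler_rat.
  exact: eigen_bound0.
(* The eigenvalues of the difference vector are partial sums, so those of [x] are their
   differences. *)
have laE : la t.+1 = la' t.+1 - la' t.
  by rewrite /la' [X in X - _]big_ord_recr /= addrAC subrr add0r.
have b1 := (bnd t.+1).1; have b2 := (bnd t).1.
have triv : `|la t.+1| <= (johnson_degree a b' t.+1 + johnson_degree a b' t)%:R.
  by rewrite laE natrD (le_trans (ler_normB _ _)) // lerD.
split=> [|_]; first by rewrite (le_trans triv) // ler_nat johnson_degree_pascal.
have [n14|n14] := leqP 14 (a + b').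
  have [h|h] := boolP ((a <= t)%N || (b' <= t)%N).
    by rewrite (le_trans triv) // !natF -rmorphM ler_rat eigen_bound_boundary.
  move: h; rewrite negb_or -!ltnNge => /andP[ta tb].
  (* For a constant difference vector the induction gives no sharp bound, but its eigenvalues are
     the degrees themselves, so the cancellation in their difference can be kept. *)
  have [/constant_onP gc|gnc] := boolP (constant_on (layer (X :\ i :\ j) a) g).
    have la'E := @layer_eigen_const _ _ _ a b' g la' (g u) Xab' _ _ _ ex'.
    have := eigen_bound_linear rat a b' t.
    rewrite laE !la'E ?subr_eq0 //; try (by move=> w wX; exact: gc);
      try (by apply/set0Pn; exists u).
    rewrite !natF -rmorphM -rmorphB -ratr_norm ler_rat //.
  rewrite laE (le_trans (ler_normB _ _)) //.
  rewrite (le_trans (lerD ((bnd t.+1).2 gnc) ((bnd t).2 gnc))) //.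
  by rewrite !natF -!rmorphM -rmorphD ler_rat eigen_bound_step.
rewrite (le_trans triv) // (le_trans (y := (johnson_degree a.+1 b'.+1 t.+1)%:R)) //.
  by rewrite ler_nat johnson_degree_pascal.
rewrite ler_peMr // -(rmorph1 (@ratr F)) ler_rat.
by apply: eigen_bound_small; rewrite addSn addnS; exact: leqW n14.
Qed.

End LayerEigenBound.

(** * The sum of all exchanges of two points *)

Section SwapSum.
Variables (I : finType) (F : numFieldType).
Implicit Types (u v w : {set I}) (i j : I) (x : {set I} -> F).

Definition swap i j u : {set I} := tperm i j @^-1: u.

Lemma swapK i j : involutive (swap i j).
Proof. by move=> u; apply/setP => k; rewrite !inE tpermK. Qed.

Lemma card_swap i j u : #|swap i j u| = #|u|.
Proof. exact: card_preimset (@perm_inj _ _). Qed.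

Lemma swap_layer i j u a : (swap i j u \in layer setT a) = (u \in layer setT a).
Proof. by rewrite !inE !subsetT card_swap. Qed.

Lemma card_setD_sum v u : #|v :\: u| = (\sum_k ((k \in v) && (k \notin u)))%N.
Proof.
by rewrite -sum1_card big_mkcond; apply: eq_bigr => k _; rewrite inE andbC; case: ifP.
Qed.

(** Only the summands at [i] and [j] change. Additions on both sides avoid truncated subtraction. *)
Lemma card_setD_swap i j v u :
  (#|v :\: swap i j u| + ((i \in v) && (i \notin u)) + ((j \in v) && (j \notin u)) =
   #|v :\: u| + ((i \in v) && (j \notin u)) + ((j \in v) && (i \notin u)))%N.
Proof.
rewrite !card_setD_sum; have [->|ij] := eqVneq i j.
  by congr (_ + _ + _)%N; apply: eq_bigr => k _; rewrite inE tperm1 perm1.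
rewrite (bigD1 i) // (bigD1 j) 1?eq_sym //= [in RHS](bigD1 i) // [in RHS](bigD1 j) 1?eq_sym //=.
rewrite !inE tpermL tpermR.
have -> : (\sum_(k | (k != i) && (k != j)) ((k \in v) && (k \notin swap i j u)) =
  \sum_(k | (k != i) && (k != j)) ((k \in v) && (k \notin u)))%N.
  by apply: eq_bigr => k /andP[ki kj]; rewrite inE tpermD // eq_sym.
lia.
Qed.

Lemma sum_mem_card (A : {set I}) : \sum_i (i \in A)%:R = #|A|%:R :> F.
Proof. by rewrite -sum1_card natr_sum [RHS]big_mkcond; apply: eq_bigr => i _; case: ifP. Qed.

Lemma sum_mem_card2 (A B : {set I}) :
  \sum_i \sum_j ((i \in A)%:R * (j \in B)%:R) = #|A|%:R * #|B|%:R :> F.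
Proof.
under eq_bigr do rewrite -mulr_sumr sum_mem_card.
by rewrite -mulr_suml sum_mem_card.
Qed.

(* Number of ordered pairs of points whose exchange increases the distance [d]
   of two [a]-sets by one. *)
Definition swap_up (a d : nat) : F := 2 * ((a%:R - d%:R) * (#|I|%:R - a%:R - d%:R)).

(** An exchange changes the distance [d] by at most one. It falls when one point lies in [v :\: u]
    and the other in [u :\: v], which gives [2 d^2] ordered pairs; it rises when one lies in
    [u :&: v] and the other outside [u :|: v]. *)
Lemma swap_count a v u t : v \in layer setT a -> u \in layer setT a ->
  let d := #|v :\: u| in
  \sum_i \sum_j (#|v :\: swap i j u| == t)%:R =
  (d == t.+1)%:R * (2 * t.+1%:R ^+ 2) +
  (d == t)%:R * (#|I|%:R ^+ 2 - 2 * t%:R ^+ 2 - swap_up a t) +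
  (d.+1 == t)%:R * swap_up a t.-1 :> F.
Proof.
rewrite !inE !subsetT => /eqP va /eqP ua; set d := #|v :\: u| => /=.
have ud : #|u :\: v| = d.
  by have := cardsID v u; have := cardsID u v; rewrite setIC -/d; lia.
have uv : #|u :&: v|%:R = a%:R - d%:R :> F.
  by rewrite -va -(cardsID u v) -/d natrD addrK setIC.
have oo : #|~: (u :|: v)|%:R = #|I|%:R - a%:R - d%:R :> F.
  have : (#|I| = #|~: (u :|: v)| + a + d)%N.
    by rewrite -(cardsC (u :|: v)) -ud -va -(cardsID v (u :|: v)) setIUl setIid
      (setUidPr (subsetIr _ _)) setDUl setDv setU0 addnC addnA.
  by move=> ->; rewrite !natrD; ring.
have E i j : (#|v :\: swap i j u| == t)%:R = 
  (d == t.+1)%:R * ((i \in v :\: u)%:R * (j \in u :\: v)%:R +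
                    (i \in u :\: v)%:R * (j \in v :\: u)%:R) +
  (d == t)%:R * (1 - (i \in v :\: u)%:R * (j \in u :\: v)%:R -
                    (i \in u :\: v)%:R * (j \in v :\: u)%:R
                 - (i \in u :&: v)%:R * (j \in ~: (u :|: v))%:R
                 - (i \in ~: (u :|: v))%:R * (j \in u :&: v)%:R) +
  (d.+1 == t)%:R * ((i \in u :&: v)%:R * (j \in ~: (u :|: v))%:R
                 + (i \in ~: (u :|: v))%:R * (j \in u :&: v)%:R) :> F.
  have := card_setD_swap i j v u; rewrite -/d !inE.
  move: #|v :\: swap i j u| => d'; move: (d) => {ud uv oo}d.
  case: (i \in v); case: (j \in v); case: (i \in u); case: (j \in u);
    rewrite ?addn0 ?addn1 /= => e; 
    first [have -> : d' = d by lia | have -> : d = d'.+1 by lia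
          | have -> : d' = d.+1 by lia]; rewrite ?eqSS; ring.
have sum2 (A B : {set I}) : \sum_p ((p.1 \in A)%:R * (p.2 \in B)%:R) =
    #|A|%:R * #|B|%:R :> F.
  by rewrite -sum_mem_card2 pair_bigA.
rewrite pair_bigA; under eq_bigr do rewrite E.
rewrite !big_split /= -!mulr_sumr !sumrB !big_split /= !sum2 sumr_const.
rewrite card_prod ud -/d uv oo /swap_up natrM.
have [->|] := eqVneq d t.+1.
  by rewrite (gtn_eqF (ltnSn t)) (gtn_eqF (ltnW (ltnSn t.+1))) /=; ring.
have [-> _|] := eqVneq d t.
  by rewrite (gtn_eqF (ltnSn t)) /=; ring.
case: t {E} => [|t] /=; first by move=> *; ring.
by move=> _ _; rewrite eqSS; case: eqP => [->|_] /=; ring.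
Qed.

(* The sum of all swaps times the relation at distance [t] is a combination of
   the relations at distances [t-1], [t], [t+1] with a nonzero coefficient at
   [t+1], so an eigenvector of the former is one of every relation. *)
Lemma swap_eigen_layer_eigen a x theta :
  (forall v, v \in layer setT a -> \sum_i \sum_j x (swap i j v) = theta * x v) ->
  exists la, layer_eigen setT a x la.
Proof.
move=> Sx.
pose A t v := \sum_(w in layer setT a | #|v :\: w| == t) x w.
suff H : forall t, exists l, forall v, v \in layer setT a -> A t v = l * x v.
  by have [la Hla] := choice H; exists la.
have rec t v : v \in layer setT a -> theta * A t v =
    2 * t.+1%:R ^+ 2 * A t.+1 v +
    (#|I|%:R ^+ 2 - 2 * t%:R ^+ 2 - swap_up a t) * A t v +
    (if t is t'.+1 then swap_up a t' * A t' v else 0).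
  move=> vL; rewrite mulr_sumr.
  under eq_bigr => w /andP[wL _] do rewrite -Sx //.
  rewrite exchange_big /=.
  under eq_bigr do rewrite exchange_big /=.
  transitivity (\sum_i \sum_j \sum_(u in layer setT a | #|v :\: swap i j u| == t) x u).
    apply: eq_bigr => i _; apply: eq_bigr => j _.
    rewrite (reindex_inj (inv_inj (swapK i j))) /=.
    by apply: eq_big => u; rewrite ?swap_layer // swapK.
  transitivity (\sum_(u in layer setT a) x u * \sum_i \sum_j (#|v :\: swap i j u| == t)%:R).
    under eq_bigr do under eq_bigr do rewrite big_mkcondr.
    under eq_bigr do rewrite exchange_big /=.
    rewrite exchange_big; apply: eq_bigr => u _; rewrite mulr_sumr.
    apply: eq_bigr => i _; rewrite mulr_sumr; apply: eq_bigr => j _.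
    by case: eqP; rewrite ?mulr1 ?mulr0.
  under eq_bigr => u uL do rewrite (swap_count t vL uL) mulrDr [X in X + _]mulrDr.
  rewrite !big_split /=; congr (_ + _ + _).
  - rewrite /A [RHS]mulr_sumr [RHS]big_mkcondr; apply: eq_bigr => u _.
    by case: eqP => _ /=; ring.
  - rewrite /A [RHS]mulr_sumr [RHS]big_mkcondr; apply: eq_bigr => u _.
    by case: eqP => _ /=; ring.
  - case: t => [|t]; first by rewrite big1 // => u _; rewrite mul0r mulr0.
    rewrite /A [RHS]mulr_sumr [RHS]big_mkcondr; apply: eq_bigr => u _.
    by rewrite eqSS; case: eqP => _ /=; ring.
have A0 v : v \in layer setT a -> A 0%N v = 1 * x v.
  move=> vL; rewrite mul1r /A (big_pred1 v) // => w /=; rewrite cards_eq0 setD_eq0.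
  move: vL; rewrite !inE !subsetT /= => /eqP va.
  apply/andP/eqP => [[/eqP wa vw]|->]; last by rewrite va.
  by apply/esym/eqP; rewrite eqEcard vw va wa /=.
(* The recurrence has three terms, so two consecutive distances go through the induction
   together. *)
move=> t; suff [] : (exists l, forall v, v \in layer setT a -> A t v = l * x v) /\
  (exists l, forall v, v \in layer setT a -> A t.+1 v = l * x v) by [].
have step s l : (forall v, v \in layer setT a -> A s v = l * x v) ->
    (if s is s'.+1 then exists l, forall v, v \in layer setT a -> A s' v = l * x v else True) ->
    exists l, forall v, v \in layer setT a -> A s.+1 v = l * x v.
  move=> Hs Hs'.
  have [l' Hl'] : exists l', forall v, v \in layer setT a ->
      (if s is t'.+1 then swap_up a t' * A t' v else 0) = l' * x v.
    case: s Hs' {Hs} => [_|s [l' Hl']]; first by exists 0 => v _; rewrite mul0r.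
    by exists (swap_up a s * l') => v vL; rewrite Hl' // mulrA.
  exists ((theta * l - (#|I|%:R ^+ 2 - 2 * s%:R ^+ 2 - swap_up a s) * l - l')
            / (2 * s.+1%:R ^+ 2)) => v vL.
  have nz : 2 * s.+1%:R ^+ 2 != 0 :> F by rewrite mulf_neq0 ?expf_neq0 ?pnatr_eq0.
  apply: (mulfI nz); have := rec s v vL; rewrite Hs // Hl' // => h.
  rewrite [RHS](mulrA (2 * s.+1%:R ^+ 2)) [X in _ = X * _](mulrC (2 * _)) divfK //; move/eqP: h.
  by rewrite -addrA -subr_eq => /eqP <-; ring.
elim: t => [|t [IH1 IH2]]; first by split; [exists 1|apply: (step 0%N 1)].
by split=> //; case: IH2 => l Hl; apply: (step t.+1 l).
Qed.

End SwapSum.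

(** * Quadratic forms of the distance relations *)

Section QuadraticForm.
Variables (I : finType) (C : numClosedFieldType).
Local Open Scope sesquilinear_scope.

(** The matrix [M] of the sum of all swaps is Hermitian, so a unitary [P] diagonalises it. By
    [swap_eigen_layer_eigen] the rows of [P] are eigenvectors of every distance relation, and in
    this basis the form is a sum of [la j t] times squared coordinates of [x]. *)
Lemma layer_quadratic_form a b t (x : {set I} -> C) : #|I| = (a + b)%N ->
    \sum_(v in layer setT a) x v = 0 ->
  `|\sum_(v in layer [set: I] a)
      \sum_(w in layer setT a | #|v :\: w| == t) x v * (x w)^*| <=
  (johnson_degree a b t)%:R * ratr (eigen_bound rat a b t) *
    \sum_(v in layer setT a) `|x v| ^+ 2.
Proof.
move=> Iab x0; set L := layer _ a in x0 *.
have [L0|[v0 v0L]] := set_0Vmem L.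
  by rewrite L0 !big_set0 normr0 mulr0.
pose ev (i : 'I_#|L|) : {set I} := enum_val i.
pose rk v := enum_rank_in v0L v.
have evK : cancel ev rk by exact: enum_valK_in.
have rkK v : v \in L -> ev (rk v) = v by exact: enum_rankK_in.
have evL i : ev i \in L by exact: enum_valP.
pose M : 'M[C]_#|L| :=
  \matrix_(i, k) \sum_p \sum_q (swap p q (ev i) == ev k)%:R.
have Mh : M ^t* = M.
  apply/matrixP => i k; rewrite !mxE rmorph_sum; apply: eq_bigr => p _.
  rewrite rmorph_sum; apply: eq_bigr => q _; rewrite rmorph_nat.
  suff -> : (swap p q (ev k) == ev i) = (swap p q (ev i) == ev k) by [].
  by apply/idP/idP => /eqP <-; rewrite swapK.
have /orthomx_spectralP : M \is normalmx by apply/normalmxP; rewrite Mh.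
set P := spectralmx M; set dd := spectral_diag M => ME.
have PU : P \is unitarymx := spectral_unitarymx M.
have PM : P *m M = diag_mx dd *m P.
  by rewrite {1}ME !mulmxA mulmxV ?mul1mx // spectral_unit.
pose f j v : C := P j (rk v).
have sw j v : v \in L -> \sum_p \sum_q f j (swap p q v) = dd 0 j * f j v.
  move=> vL; have /matrixP/(_ j (rk v)) := PM; rewrite mul_diag_mx !mxE => <-.
  under [RHS]eq_bigr do rewrite mxE mulr_sumr.
  rewrite [RHS]exchange_big; apply: eq_bigr => p _.
  under [RHS]eq_bigr do rewrite mulr_sumr.
  rewrite [RHS]exchange_big; apply: eq_bigr => q _.
  rewrite (bigD1 (rk (swap p q v))) //= rkK ?swap_layer // swapK rkK // eqxx mulr1.
  rewrite big1 ?addr0 // => i ine; case: eqP => [e|_]; rewrite ?mulr0 //.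
  by case/eqP: ine; rewrite -e swapK evK.
have [la Hla] := choice (fun j => swap_eigen_layer_eigen (sw j)).
pose B : 'M[C]_#|L| := \matrix_(i, k) (#|ev i :\: ev k| == t)%:R.
have distC v w : v \in L -> w \in L -> #|v :\: w| = #|w :\: v|.
  rewrite !inE => /andP[_ /eqP va] /andP[_ /eqP wa].
  by have := cardsID w v; have := cardsID v w; rewrite setIC; lia.
pose dl : 'rV[C]_#|L| := \row_j la j t.
have PB : P *m B = diag_mx dl *m P.
  apply/matrixP => j k; rewrite mul_diag_mx !mxE.
  have := Hla j t (ev k) (evL k); rewrite /f evK => <-.
  rewrite [RHS]big_mkcondr [RHS]big_enum_val; apply: eq_bigr => i _.
  rewrite !mxE -/(ev i) evK distC //.
  by case: eqP; rewrite ?mulr1 ?mulr0.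
have BE : B = P ^t* *m diag_mx dl *m P.
  by rewrite -mulmxA -PB mulmxA -(invmx_unitary PU) mulVmx ?mul1mx // unitarymx_unit.
pose X : 'rV[C]_#|L| := \row_i x (ev i).
pose Y := X *m P ^t*.
have quad : \sum_(v in L) \sum_(w in L | #|v :\: w| == t) x v * (x w)^* =
    \sum_j la j t * `|Y 0 j| ^+ 2.
  have -> : \sum_(v in L) \sum_(w in L | #|v :\: w| == t) x v * (x w)^* =
      (X *m B *m X ^t*) 0 0.
    rewrite -mulmxA mxE [LHS]big_enum_val; apply: eq_bigr => i _.
    rewrite !mxE mulr_sumr [LHS]big_mkcondr [LHS]big_enum_val; apply: eq_bigr => k _.
    by rewrite !mxE -/(ev k) -/(ev i); case: eqP; rewrite ?mul1r ?mul0r ?mulr0.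
  have -> : X *m B *m X ^t* = Y *m diag_mx dl *m Y ^t*.
    by rewrite BE /Y trmx_mul map_mxM trmxCK !mulmxA.
  rewrite mxE; apply: eq_bigr => j _.
  by rewrite mul_mx_diag !mxE normCK; ring.
have normXY : \sum_(v in L) `|x v| ^+ 2 = \sum_j `|Y 0 j| ^+ 2.
  transitivity ((X *m X ^t*) 0 0).
    rewrite mxE [LHS]big_enum_val; apply: eq_bigr => i _.
    by rewrite !mxE -/(ev i) normCK.
  have -> : X *m X ^t* = Y *m Y ^t*.
    rewrite /Y trmx_mul map_mxM trmxCK mulmxA mulmxKtV //.
  by rewrite mxE; apply: eq_bigr => j _; rewrite !mxE normCK.
rewrite quad normXY mulr_sumr (le_trans (ler_norm_sum _ _ _)) //.
apply: ler_sum => j _; rewrite normrM [X in _ * X <= _]ger0_norm ?exprn_ge0 //.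
(* Along a constant eigenvector the coordinate of [x] is a multiple of the sum of [x], which is
   zero. *)
have [fc|fnc] := boolP (constant_on L (f j)).
  suff -> : Y 0 j = 0 by rewrite normr0 expr0n /= !mulr0.
  rewrite mxE; under eq_bigr do rewrite !mxE.
  have fE i : P j i = f j v0.
    by have /constant_onP/(_ _ _ (evL i) v0L) <- := fc; rewrite /f evK.
  under eq_bigr do rewrite fE.
  by rewrite -mulr_suml -(big_enum_val x) x0 mul0r.
apply: ler_wpM2r; first by rewrite exprn_ge0.
have ex : exists2 v, v \in L & f j v != 0.
  have : (P *m P ^t*) j j = 1 by rewrite (unitarymxP PU) mxE eqxx.
  apply: contraPP => H; rewrite mxE big1 => [/eqP|i _]; first by rewrite eq_sym oner_eq0.
  suff -> : P j i = 0 by rewrite mul0r.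
  apply: contrapT => /eqP nz; apply: H; exists (ev i) => //.
  by rewrite /f evK.
have Xab : #|[set: I]| = (a + b)%N by rewrite cardsT.
exact: (layer_eigen_bound Xab (Hla j) ex t).2.
Qed.

End QuadraticForm.

From mathcomp Require Import complex.
From mathcomp Require Import all_classical all_reals all_analysis.
Import Order.TTheory GRing.Theory Num.Theory.
Import numFieldNormedType.Exports.

(** * Edge counts and modularity *)

Section EdgeCounts.
Variables (V : finType) (E : {set {set V}}).
Hypothesis E2 : forall e, e \in E -> #|e| = 2.
Implicit Types (u v : V) (S A : {set V}).

Definition linked u v : bool := [set u; v]%SET \in E.

Lemma linkedC u v : linked u v = linked v u.
Proof. by rewrite /linked finset.setUC. Qed.

Lemma edges_inside_double S :
  (2 * edges_inside E S = \sum_(u in S) \sum_(v in S) linked u v)%N.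
Proof.
rewrite pair_big /=.
have -> : (\sum_(p | (p.1 \in S) && (p.2 \in S)) linked p.1 p.2 =
  \sum_(p | [set p.1; p.2]%SET \in [set e in E | e \subset S]%SET) 1)%N.
  rewrite big_mkcond [RHS]big_mkcond; apply: eq_bigr => -[u v] _ /=.
  rewrite inE finset.subUset !finset.sub1set /linked.
  by case: (u \in S); case: (v \in S); case: (_ \in E).
rewrite (partition_big (fun p => [set p.1; p.2]%SET)
  (mem [set e in E | e \subset S]%SET)) //=.
rewrite mulnC -sum_nat_const; apply: eq_bigr => e; rewrite inE => /andP[eE eS].
rewrite sum1dep_card; have /eqP/cards2P[x [y [xy e_eq]]] := E2 eE.
have -> : [set p | (([set p.1; p.2] \in [set e0 in E | e0 \subset S]) &&
     ([set p.1; p.2] == e))]%SET = [set (x, y); (y, x)]%SET.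
  apply/setP => -[u v]; rewrite !inE /=; apply/idP/idP; last first.
    by case/orP => /eqP[-> ->]; rewrite ?(finset.setUC [set y]) -e_eq eE eS eqxx.
  case/andP=> _ /eqP; rewrite e_eq => /setP H.
  have := H x; have := H y; have := H u; have := H v.
  rewrite !inE !eqxx ?orbT !xpair_eqE.
  do ![case: eqVneq => //= ?]; subst; rewrite ?eqxx in xy *; by [].
by rewrite cards2 xpair_eqE negb_and xy.
Qed.

Lemma degreeE v : degree E v = (\sum_u linked v u)%N.
Proof.
have -> : (\sum_u linked v u = #|[set u | linked v u]%SET|)%N.
  by rewrite -sum1_card [RHS]big_mkcond; apply: eq_bigr => u _; rewrite inE; case: ifP.
rewrite /degree -(card_in_imset (f := fun u => [set v; u]%SET)); last first.
  move=> u w; rewrite !inE => /E2 /eqP; rewrite cards2 => /eqP[]; case: eqP => // vu _ _ /setP H.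
  by have := H u; rewrite !inE eqxx orbT; case: eqVneq => [/esym //|_ /= /esym/eqP].
apply: eq_card => e; rewrite !inE; apply/andP/imsetP => [[eE ve]|[u]].
  have /eqP/cards2P[x [y [xy e_eq]]] := E2 eE.
  move: ve; rewrite e_eq !inE => /orP[] /eqP->.
    by exists y; rewrite // inE /linked -e_eq.
  by exists x; rewrite ?inE /linked finset.setUC -?e_eq.
by rewrite inE => ? ->; rewrite !inE eqxx.
Qed.

Definition volume S : nat := (\sum_(v in S) degree E v)%N.

Lemma volume_setT : volume [set: V]%SET = (2 * #|E|)%N.
Proof.
have -> : #|E| = edges_inside E [set: V]%SET.
  by apply: eq_card => e; rewrite inE finset.subsetT andbT.
rewrite edges_inside_double; apply: eq_bigr => v _.
by rewrite degreeE; apply: eq_bigl => u; rewrite inE.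
Qed.

(** Edges across the cut count once in the volume of [S] and edges inside [S] twice. The volume is
    thus determined by edge counts inside vertex sets, the only quantities that concentration
    controls. *)
Lemma volume_edges_inside S :
  (volume S + edges_inside E (~: S) = edges_inside E S + #|E|)%N.
Proof.
apply/eqP; rewrite -(eqn_pmul2l (isT : (0 < 2)%N)) !mulnDr !edges_inside_double -volume_setT.
have -> : volume [set: V]%SET = (volume S + volume (~: S))%N.
  rewrite /volume (bigID (mem S)) /=; congr (_ + _)%N; apply: eq_bigl => v; rewrite !inE //.
have volE A : volume A =
    (\sum_(u in A) \sum_(v in A) linked u v + \sum_(u in A) \sum_(v in ~: A) linked u v)%N.
  rewrite -big_split; apply: eq_bigr => u _; rewrite degreeE (bigID (mem A)) /=.
  by congr (_ + _)%N; apply: eq_bigl => v; rewrite !inE.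
rewrite !volE finset.setCK [X in (_ == _ + (_ + (_ + X)))%N]exchange_big /=.
under [X in (_ == _ + (_ + (_ + X)))%N]eq_bigr do under eq_bigr do rewrite linkedC.
apply/eqP; lia.
Qed.

End EdgeCounts.

(** * Merging blocks into few classes *)

Section Coloring.
Variable R : realType.

Lemma exists_ge_mean m (f : 'I_m.+1 -> R) :
  exists k, (\sum_i f i) / m.+1%:R <= f k.
Proof.
apply: contrapT => H.
have lt k : f k < (\sum_i f i) / m.+1%:R.
  by rewrite ltNge; apply/negP => h; apply: H; exists k.
have : \sum_i f i < \sum_(i < m.+1) (\sum_i f i) / m.+1%:R.
  apply: ltr_sum => //; apply/hasP; exists ord0 => //.
by rewrite sumr_const card_ord -[X in _ < X]mulr_natr divfK ?ltxx.
Qed.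

(* The blocks are coloured one after the other; the colour of a new block is
   chosen so that it gains at least the average over all colours. *)
Lemma coloring_ge_mean (T : eqType) (s : seq T) (B : T -> T -> R) m : uniq s ->
  exists c : T -> 'I_m.+1,
    (1 - m.+1%:R^-1) * (\sum_(i <- s) B i i) +
      m.+1%:R^-1 * (\sum_(i <- s) \sum_(j <- s) B i j) <=
    \sum_(i <- s) \sum_(j <- s) (c i == c j)%:R * B i j.
Proof.
elim: s => [_|x s IH /= /andP[xs us]].
  by exists (fun=> ord0); rewrite !big_nil !mulr0 addr0.
have [c Hc] := IH us.
(* [g k] is the gain from giving colour [k] to [x]; each old block contributes for exactly one
   [k]. *)
pose g (k : 'I_m.+1) := \sum_(j <- s) (c j == k)%:R * (B x j + B j x).
have [k Hk] := exists_ge_mean g.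
exists (fun i => if i == x then k else c i).
have cs i : i \in s -> (if i == x then k else c i) = c i.
  by move=> si; case: eqP xs => // <-; rewrite si.
have sumg : \sum_k g k = \sum_(j <- s) (B x j + B j x).
  rewrite exchange_big; apply: eq_bigr => j _.
  by rewrite -mulr_suml (bigD1 (c j)) //= eqxx big1 ?addr0 ?mul1r // => i;
     rewrite eq_sym => /negbTE->.
have Sx (F : T -> T -> R) : \sum_(i <- x :: s) \sum_(j <- x :: s) F i j =
    F x x + \sum_(j <- s) (F x j + F j x) + \sum_(i <- s) \sum_(j <- s) F i j.
  under eq_bigr do rewrite big_cons.
  by rewrite big_cons !big_split /= -!addrA.
rewrite !Sx big_cons !eqxx /= mul1r.
have -> : \sum_(i <- s) \sum_(j <- s)
    ((if i == x then k else c i) == (if j == x then k else c j))%:R * B i j =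
    \sum_(i <- s) \sum_(j <- s) (c i == c j)%:R * B i j.
  by apply: eq_big_seq => i si; apply: eq_big_seq => j sj; rewrite !cs.
have -> : \sum_(j <- s) ((k == (if j == x then k else c j))%:R * B x j +
     ((if j == x then k else c j) == k)%:R * B j x) = g k.
  by apply: eq_big_seq => j sj; rewrite cs // [k == _]eq_sym mulrDr.
move: Hk Hc; rewrite sumg [_ / _]mulrC; set q := m.+1%:R^-1.
rewrite !mulrDr.
lra.
Qed.

Variables (V : finType) (E : {set {set V}}).
Hypothesis E2 : forall e, e \in E -> #|e| = 2.

Definition block_score (S : {set V}) : R :=
  (edges_inside E S)%:R / #|E|%:R - (volume E S)%:R ^+ 2 / (4 * #|E|%:R ^+ 2).

(** Entry of the modularity matrix divided by twice the number of edges. *)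
Definition pair_score (u v : V) : R :=
  (linked E u v)%:R / (2 * #|E|%:R) -
  (degree E u)%:R * (degree E v)%:R / (4 * #|E|%:R ^+ 2).

Lemma block_scoreE S :
  block_score S = \sum_(u in S) \sum_(v in S) pair_score u v.
Proof.
under eq_bigr do rewrite sumrB -!mulr_suml -mulr_sumr.
rewrite sumrB -!mulr_suml -[X in _ - X / _]/(_ * _); congr (_ - _ / _).
  have -> : \sum_(i in S) \sum_(i0 in S) (linked E i i0)%:R = (2 * edges_inside E S)%:R :> R.
    rewrite edges_inside_double // natr_sum; apply: eq_bigr => u _.
    by rewrite natr_sum.
  by rewrite natrM invfM mulrACA divff ?mul1r // pnatr_eq0.
by rewrite /volume natr_sum expr2.
Qed.

Lemma block_score_setT : block_score [set: V]%SET = 0.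
Proof.
rewrite /block_score volume_setT //.
have -> : edges_inside E [set: V]%SET = #|E|.
  by apply: eq_card => e; rewrite inE finset.subsetT andbT.
have [->|/eqP M0] := eqVneq #|E| 0%N; first by rewrite muln0 expr0n /= !mul0r subrr.
have M0' : #|E|%:R != 0 :> R by rewrite pnatr_eq0; apply/eqP.
by rewrite natrM; field.
Qed.

Lemma partition_scoreE (AA : {set {set V}}) :
  partition_score R E AA = \sum_(A in AA) block_score A.
Proof. by rewrite /partition_score sumrB. Qed.

(** The scores of all pairs of blocks add up to the score of the whole vertex set, which is zero, so
    a colouring no worse than average loses only the factor [1 - 1/(m+1)]. The number of classes,
    and with it the number of error terms, no longer depends on the partition. *)
Lemma partition_score_coloring (AA : {set {set V}}) m :
    finset.partition AA [set: V]%SET ->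
  exists f : V -> 'I_m.+1, (1 - m.+1%:R^-1) * partition_score R E AA <=
    \sum_i block_score [set v | f v == i]%SET.
Proof.
move=> pAA; have [/eqP cAA tAA _] := and3P pAA.
pose B (A A' : {set V}) := \sum_(u in A) \sum_(v in A') pair_score u v.
have [c Hc] := coloring_ge_mean B m (enum_uniq AA).
exists (fun v => c (finset.pblock AA v)).
have inb u : u \in finset.cover AA by rewrite cAA inE.
have sumAA (F : V -> R) : \sum_u F u = \sum_(A in AA) \sum_(u in A) F u.
  by rewrite -(finset.big_trivIset _ tAA) cAA; apply: eq_bigl => u; rewrite inE.
have zero : \sum_(A <- enum AA) \sum_(A' <- enum AA) B A A' = 0.
  rewrite -[RHS]block_score_setT block_scoreE.
  have BA A : \sum_(A' <- enum AA) B A A' = \sum_(u in A) \sum_v pair_score u v.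
    rewrite big_enum exchange_big; apply: eq_bigr => u _.
    by rewrite [RHS]sumAA.
  rewrite (eq_bigr _ (fun A _ => BA A)) big_enum /=.
  by rewrite -sumAA; apply: eq_big => [u|u _]; rewrite ?inE //;
     apply: eq_bigl => v; rewrite inE.
rewrite zero mulr0 addr0 in Hc.
rewrite partition_scoreE.
have -> : \sum_(A in AA) block_score A = \sum_(A <- enum AA) B A A.
  by rewrite big_enum; apply: eq_bigr => A _; rewrite block_scoreE.
rewrite (le_trans Hc) // le_eqVlt; apply/orP; left; apply/eqP.
rewrite big_enum /=.
transitivity (\sum_u \sum_v (c (finset.pblock AA u) == c (finset.pblock AA v))%:R * pair_score u v).
  rewrite sumAA; apply: eq_bigr => A AAA; rewrite big_enum /=.
  under [RHS]eq_bigr do rewrite sumAA.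
  rewrite [RHS]exchange_big; apply: eq_bigr => A' AA'.
  rewrite mulr_sumr; apply: eq_bigr => u uA; rewrite mulr_sumr; apply: eq_bigr => v vA'.
  by rewrite (finset.def_pblock tAA AAA uA) (finset.def_pblock tAA AA' vA').
under [RHS]eq_bigr do rewrite block_scoreE big_mkcond.
rewrite [RHS]exchange_big; apply: eq_bigr => u _.
rewrite (bigD1 (c (finset.pblock AA u))) //= inE eqxx [X in _ + X]big1 ?addr0; last first.
  by move=> i ine; rewrite inE eq_sym (negbTE ine).
rewrite [RHS]big_mkcond; apply: eq_bigr => v _; rewrite inE eq_sym.
by case: eqP; rewrite ?mul1r ?mul0r.
Qed.

End Coloring.

(** * Modularity of a subgraph of a regular expander *)

Section Perturbation.
Variable R : realType.

(** Here [sg] is the density of the block, [x] its inner edges, [v] its volume and [e] the size of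
    the subgraph. The main terms [sg^2] cancel and leave [rho sg]. All errors except [2 eps] are
    kept proportional to [sg], as densities sum to 1 over the classes; [41 = 5 + 2 + 34] collects
    the volume error, [2 eps sg^2] and [2 eps rho sg] with [rho <= 17]. *)
Lemma block_perturbation (eps rho sg p M x v e : R) :
    0 < eps -> eps <= 1 / 2 -> 0 <= rho -> rho <= 17 -> 0 <= sg -> sg <= 1 ->
    0 < p * M -> x <= p * M * (sg ^+ 2 + rho * sg + eps) -> 0 <= v ->
    p * M * (2 * sg - 3 * eps) <= v ->
    p * M * (1 - eps) <= e -> e <= p * M * (1 + eps) ->
  x / e - v ^+ 2 / (4 * e ^+ 2) <= rho * sg + 2 * eps + 41 * eps * sg.
Proof.
move=> eps0 eps2 rho0 rho17 sg0 sg1; move: (p * M) => q q0 hx v0 hv e1 e2.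
have e0 : 0 < e by apply: lt_le_trans e1; rewrite mulr_gt0 //; lra.
pose y := v / (2 * e).
have y0 : 0 <= y by rewrite divr_ge0 // mulr_ge0 // ltW.
have -> : v ^+ 2 / (4 * e ^+ 2) = y ^+ 2 by rewrite /y; field; rewrite gt_eqF.
have hy : sg ^+ 2 - 5 * eps * sg <= y ^+ 2.
  (* For small [sg] the left-hand side is nonpositive; otherwise the lower bound for [y] is positive
     and may be squared. *)
  have [h|h] := leP (2 * sg) (5 * eps).
    have : 0 <= sg * (5 * eps - 2 * sg) by rewrite mulr_ge0 //; lra.
    have := sqr_ge0 y; have := sqr_ge0 sg; lra.
  have yl : sg - 5 / 2 * eps <= y.
    rewrite /y ler_pdivlMr ?mulr_gt0 //; apply: le_trans hv.
    have : (sg - 5 / 2 * eps) * (2 * e) <= (sg - 5 / 2 * eps) * (2 * (q * (1 + eps))).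
      by rewrite ler_wpM2l //; lra.
    move=> /le_trans; apply.
    have -> : (sg - 5 / 2 * eps) * (2 * (q * (1 + eps))) =
       q * ((2 * sg - 5 * eps) * (1 + eps)) by field.
    rewrite ler_pM2l //.
    have : 0 <= eps * (1 - sg) by rewrite mulr_ge0 //; lra.
    have := sqr_ge0 eps; lra.
  have : (sg - 5 / 2 * eps) ^+ 2 <= y ^+ 2 by rewrite lerXn2r // nnegrE; lra.
  have := sqr_ge0 eps; lra.
have hxe : x / e <= (sg ^+ 2 + rho * sg + eps) * (1 + 2 * eps).
  rewrite ler_pdivrMr // (le_trans hx) //.
  set z := sg ^+ 2 + rho * sg + eps.
  have z0 : 0 <= z by rewrite !addr_ge0 ?mulr_ge0 //; lra.
  have : z * (1 + 2 * eps) * (q * (1 - eps)) <= z * (1 + 2 * eps) * e.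
    by rewrite ler_wpM2l // mulr_ge0 //; lra.
  apply: le_trans; rewrite -subr_ge0.
  have -> : z * (1 + 2 * eps) * (q * (1 - eps)) - q * z = z * q * (eps * (1 - 2 * eps)) by ring.
  by rewrite !mulr_ge0 //; lra.
have h1 : 0 <= eps * (sg - sg ^+ 2).
  by rewrite expr2 -[X in X - _]mulr1 -mulrBr !mulr_ge0 //; lra.
have h2 : 0 <= eps * (17 * sg - rho * sg).
  by rewrite -mulrBl !mulr_ge0 //; lra.
have h3 : 0 <= eps * (1 / 2 - eps) by rewrite mulr_ge0 //; lra.
lra.
Qed.

Variables (V : finType) (E F : {set {set V}}) (k : nat) (rho p eps : R).
Hypothesis E2 : forall e, e \in E -> #|e| = 2.
Hypothesis FE : F \subset E.
Hypothesis reg : forall v, degree E v = k.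
Hypothesis E0 : (0 < #|E|)%N.
Hypothesis expand : forall S : {set V},
  2 * (edges_inside E S)%:R <=
    k%:R * (#|S|%:R ^+ 2 / #|V|%:R + rho * #|S|%:R) :> R.
Hypothesis p0 : 0 < p.
Hypothesis eps0 : 0 < eps.
Hypothesis eps2 : eps <= 1 / 2.
Hypothesis rho0 : 0 <= rho.
Hypothesis rho17 : rho <= 17.
Hypothesis close : forall S : {set V},
  `|(edges_inside F S)%:R - p * (edges_inside E S)%:R| <= eps * p * #|E|%:R.

Let F2 : forall e, e \in F -> #|e| = 2.
Proof. by move=> e /(fintype.subsetP FE); exact: E2. Qed.

Let edges_setT (D : {set {set V}}) : edges_inside D [set: V]%SET = #|D|.
Proof. by apply: eq_card => e; rewrite inE finset.subsetT andbT. Qed.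

Lemma regular_card : (k * #|V| = 2 * #|E|)%N.
Proof.
rewrite -volume_setT // /volume; under eq_bigr do rewrite reg.
by rewrite sum_nat_const cardsT mulnC.
Qed.

(** By [volume_edges_inside] the volume in [F] combines the counts inside [S], its complement and
    the whole set. Three deviations of size [eps p #|E|] add up, whence the [3 eps] in
    [block_perturbation]. *)
Lemma block_score_perturbed (S : {set V}) :
  block_score R F S <= rho * (#|S|%:R / #|V|%:R) + 2 * eps +
    41 * eps * (#|S|%:R / #|V|%:R).
Proof.
set sg := #|S|%:R / #|V|%:R; have M0 : 0 < #|E|%:R :> R by rewrite ltr0n.
have V0 : 0 < #|V|%:R :> R.
  by rewrite ltr0n; have := regular_card; case: #|V| E0 => //; lia.
have kV : k%:R * #|V|%:R = 2 * #|E|%:R :> R by rewrite -!natrM regular_card.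
have Sk : #|S|%:R = sg * #|V|%:R by rewrite divfK // gt_eqF.
have volE : (volume E S)%:R = 2 * #|E|%:R * sg.
  rewrite /volume; under eq_bigr do rewrite reg.
  by rewrite sum_nat_const natrM Sk -kV; ring.
have cl A : - (eps * p * #|E|%:R) <= (edges_inside F A)%:R - p * (edges_inside E A)%:R <=
    eps * p * #|E|%:R by rewrite -ler_norml.
have := cl [set: V]%SET; rewrite !edges_setT => /andP[c1 c2].
have /andP[c3 c4] := cl S; have /andP[c5 c6] := cl (~: S)%SET.
have := congr1 (fun i => i%:R : R) (volume_edges_inside F2 S).
have := congr1 (fun i => i%:R : R) (volume_edges_inside E2 S).
rewrite /= !natrD => vE vF.
have pvE : p * (volume E S)%:R + p * (edges_inside E (~: S))%:R =
  p * (edges_inside E S)%:R + p * #|E|%:R by rewrite -!mulrDr vE.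
have ex : (edges_inside E S)%:R <= #|E|%:R * (sg ^+ 2 + rho * sg).
  have := expand S; rewrite Sk.
  have -> : k%:R * ((sg * #|V|%:R) ^+ 2 / #|V|%:R + rho * (sg * #|V|%:R)) =
    k%:R * #|V|%:R * (sg ^+ 2 + rho * sg) by field; rewrite gt_eqF.
  rewrite kV; lra.
have pex : p * (edges_inside E S)%:R <= p * (#|E|%:R * (sg ^+ 2 + rho * sg)).
  by rewrite ler_pM2l.
apply: (@block_perturbation eps rho sg p #|E|%:R) => //.
- by rewrite divr_ge0.
- by rewrite ler_pdivrMr // mul1r ler_nat max_card.
- by rewrite mulr_gt0.
- lra.
- rewrite volE in pvE; lra.
- lra.
- lra.
Qed.

(** Merge into [m+2] classes and add their scores: the densities sum to 1 and the constant error
    occurs [m+2] times. The factor [1 + 1/(m+1)] is the inverse of the loss [1 - 1/(m+2)]. *)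
Lemma modularity_perturbed m :
  modularity R F <= (1 + m.+1%:R^-1) * (rho + (2 * m.+2%:R + 41) * eps).
Proof.
have V0 : (0 < #|V|)%N by have := regular_card; case: #|V| E0 => //; lia.
have bound AA : finset.partition AA [set: V]%SET ->
    partition_score R F AA <= (1 + m.+1%:R^-1) * (rho + (2 * m.+2%:R + 41) * eps).
  move=> pAA; have [f Hf] := partition_score_coloring R F2 m.+1 pAA.
  have sum1 : \sum_(i < m.+2) #|[set v | f v == i]%SET|%:R / #|V|%:R = 1 :> R.
    rewrite -mulr_suml -natr_sum -(_ : #|V| = \sum_i #|[set v | f v == i]%SET|)%N.
      by rewrite divff // pnatr_eq0 -lt0n.
    rewrite -cardsT -sum1_card (partition_big f predT) //=; apply: eq_bigr => i _.
    by rewrite -sum1_card; apply: eq_bigl => v; rewrite !inE.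
  have : \sum_(i < m.+2) block_score R F [set v | f v == i]%SET <=
      rho + (2 * m.+2%:R + 41) * eps.
    apply: (le_trans (ler_sum _ (fun i _ => block_score_perturbed _))).
    rewrite !big_split /= -!mulr_sumr sum1 sumr_const card_ord -mulr_natr; lra.
  move=> /(le_trans Hf) h.
  have m0 : 0 < m.+1%:R :> R by rewrite ltr0n.
  have m20 : 0 < m.+2%:R :> R by rewrite ltr0n.
  have eqm : (1 + m.+1%:R^-1) * (1 - m.+2%:R^-1) = 1 :> R.
    rewrite -[m.+2%:R]natr1; move: (m.+1%:R) m0 => z z0; field.
    by rewrite !gt_eqF ?addr_gt0.
  have -> : partition_score R F AA = (1 + m.+1%:R^-1) * ((1 - m.+2%:R^-1) * partition_score R F AA).
    by rewrite mulrA eqm mul1r.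
  by rewrite ler_pM2l //.
(* The base value of the maximum comes from the one-block partition, a genuine partition since [V]
   is nonempty. *)
apply: bigmax_le => [|AA]; last exact: bound.
apply: bound; apply/and3P; split.
- by rewrite /finset.cover big_set1.
- by apply/finset.trivIsetP => A B; rewrite !inE => /eqP-> /eqP->; rewrite eqxx.
- by rewrite inE eq_sym -finset.cards_eq0 cardsT -lt0n.
Qed.

End Perturbation.

(** * Edge expansion of the Johnson graph *)

Section RealForm.
Variables (R : realType) (I : finType).

Lemma layer_quadratic_form_real a b t (x : {set I} -> R) : #|I| = (a + b)%N ->
    \sum_(v in layer [set: I]%SET a) x v = 0 ->
  \sum_(v in layer [set: I]%SET a)
      \sum_(w in layer [set: I]%SET a | #|v :\: w| == t) x v * x w <=
  (johnson_degree a b t)%:R * eigen_bound R a b t *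
    \sum_(v in layer [set: I]%SET a) x v ^+ 2.
Proof.
move=> Iab x0.
have x0C : \sum_(v in layer [set: I]%SET a) (x v)%:C%C = 0.
  by rewrite -rmorph_sum x0 rmorph0.
have := layer_quadratic_form t Iab x0C.
have -> : \sum_(v in layer [set: I]%SET a)
      \sum_(w in layer [set: I]%SET a | #|v :\: w| == t) (x v)%:C%C * ((x w)%:C%C)^* =
  (\sum_(v in layer [set: I]%SET a)
      \sum_(w in layer [set: I]%SET a | #|v :\: w| == t) x v * x w)%:C%C.
  rewrite rmorph_sum; apply: eq_bigr => v _; rewrite rmorph_sum; apply: eq_bigr => w _.
  rewrite rmorphM; congr (_ * _); apply: conj_Creal.
  by rewrite complex_real.
have -> : \sum_(v in layer [set: I]%SET a) `|(x v)%:C%C| ^+ 2 =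
  (\sum_(v in layer [set: I]%SET a) x v ^+ 2)%:C%C.
  rewrite rmorph_sum; apply: eq_bigr => v _.
  by rewrite normc_def /= expr0n addr0 sqrtr_sqr -rmorphXn /= real_normK // num_real.
have -> : ratr (eigen_bound rat a b t) = (eigen_bound R a b t)%:C%C.
  rewrite -(fmorph_rat (real_complex R)); congr (_%:C)%C.
  by rewrite /eigen_bound -!natrD -!natrM rmorphD !fmorph_div /= ratr_norm rmorphB /= !ratr_nat.
rewrite -(rmorph_nat (real_complex R)) -!rmorphM.
have := ler_norm (\sum_(v in layer [set: I]%SET a)
      \sum_(w in layer [set: I]%SET a | #|v :\: w| == t) x v * x w).
move: (\sum_(v in _) \sum_(w in _ | _) _) => z zz.
rewrite normc_def /= expr0n addr0 sqrtr_sqr lecR; exact: le_trans.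
Qed.

(** Apply the quadratic form bound to the indicator of [S] minus its density. The form becomes the
    edge count minus [k #|S|^2 / N], and the squared norm is at most [#|S|]. *)
Lemma layer_edge_bound a b t (S : {set {set I}}) : #|I| = (a + b)%N ->
  S \subset layer [set: I]%SET a ->
  \sum_(v in S) \sum_(w in S) (#|v :\: w| == t)%:R <=
  (johnson_degree a b t)%:R *
   (#|S|%:R ^+ 2 / #|layer [set: I]%SET a|%:R + eigen_bound R a b t * #|S|%:R).
Proof.
move=> Iab SL; set L := layer _ a in SL *.
have [S0|S0] := eqVneq S finset.set0.
  by rewrite S0 big_set0 finset.cards0 expr0n /= mul0r mulr0 addr0 mulr0.
have N0 : 0 < #|L|%:R :> R.
  rewrite ltr0n; apply: leq_trans (subset_leq_card SL).
  by rewrite lt0n finset.cards_eq0.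
set N := #|L|%:R in N0 *; set k := (johnson_degree a b t)%:R.
pose sg : R := #|S|%:R / N.
pose x v : R := (v \in S)%:R - sg.
have sumS : \sum_(v in L) (v \in S)%:R = #|S|%:R :> R.
  rewrite -sum1_card natr_sum [RHS]big_mkcond [LHS]big_mkcond.
  apply: eq_bigr => v _; case: ifP => //; case: ifP => // vS.
  by rewrite (fintype.subsetP SL).
have x0 : \sum_(v in L) x v = 0.
  by rewrite sumrB sumS sumr_const -[sg *+ _]mulr_natr -/N /sg divfK ?subrr // gt_eqF.
have Iab' : #|[set: I]%SET| = (a + b)%N by rewrite cardsT.
have deg v : v \in L -> \sum_(w in L | #|v :\: w| == t) 1 = k :> R.
  move=> vL; rewrite /k -(card_layer_dist t Iab' vL) -sum1_card natr_sum.
  by apply: eq_bigl => w; rewrite inE.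
have distC v w : v \in L -> w \in L -> #|v :\: w| = #|w :\: v|.
  rewrite !inE => /andP[_ /eqP va] /andP[_ /eqP wa].
  by have := cardsID w v; have := cardsID v w; rewrite finset.setIC; lia.
have := layer_quadratic_form_real t Iab x0; rewrite -/L -/k.
have -> : \sum_(v in L) \sum_(w in L | #|v :\: w| == t) x v * x w =
  \sum_(v in S) \sum_(w in S) (#|v :\: w| == t)%:R - k * (#|S|%:R ^+ 2 / N).
  have -> : \sum_(v in L) \sum_(w in L | #|v :\: w| == t) x v * x w =
    \sum_(v in L) \sum_(w in L | #|v :\: w| == t) (v \in S)%:R * (w \in S)%:R
    - sg * \sum_(v in L) \sum_(w in L | #|v :\: w| == t) (v \in S)%:R
    - sg * \sum_(v in L) \sum_(w in L | #|v :\: w| == t) x w.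
    rewrite !mulr_sumr -!sumrB; apply: eq_bigr => v _.
    rewrite !mulr_sumr -!sumrB; apply: eq_bigr => w _.
    by rewrite /x; ring.
  have -> : \sum_(v in L) \sum_(w in L | #|v :\: w| == t) x w = 0.
    under eq_bigr do rewrite big_mkcondr.
    rewrite exchange_big /= -[RHS](mulr0 k) -[in RHS]x0 mulr_sumr; apply: eq_bigr => w wL.
    rewrite -(deg w wL) mulr_suml -big_mkcondr; apply: eq_big => [v|v _]; rewrite ?mul1r //.
    by apply: andb_id2l => vL; rewrite distC.
  have -> : \sum_(v in L) \sum_(w in L | #|v :\: w| == t) (v \in S)%:R = k * #|S|%:R :> R.
    rewrite -sumS mulr_sumr; apply: eq_bigr => v vL.
    by rewrite -(deg v vL) mulr_suml; apply: eq_bigr => w _; rewrite mul1r.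
  have -> : \sum_(v in L) \sum_(w in L | #|v :\: w| == t) (v \in S)%:R * (w \in S)%:R =
    \sum_(v in S) \sum_(w in S) (#|v :\: w| == t)%:R :> R.
    rewrite [LHS]big_mkcond [RHS]big_mkcond; apply: eq_bigr => v _.
    case vS : (v \in S); last first.
      by case: ifP => // _; rewrite big1 // => w _; rewrite mul0r.
    rewrite (fintype.subsetP SL) // [LHS]big_mkcond [RHS]big_mkcond; apply: eq_bigr => w _.
    case wS : (w \in S); last by rewrite mulr0 if_same.
    by rewrite (fintype.subsetP SL) //=; case: eqP; rewrite ?mul1r.
  by rewrite /sg; ring.
have xx : \sum_(v in L) x v ^+ 2 <= #|S|%:R.
  have -> : \sum_(v in L) x v ^+ 2 = #|S|%:R - sg * #|S|%:R.
    have -> : \sum_(v in L) x v ^+ 2 = \sum_(v in L) ((v \in S)%:R - sg * (v \in S)%:R - sg * x v).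
      by apply: eq_bigr => v _; rewrite /x; case: (v \in S) => /=; ring.
    by rewrite !sumrB -!mulr_sumr x0 sumS mulr0 subr0.
  by rewrite gerBl mulr_ge0 // divr_ge0 // ltW.
have : k * eigen_bound R a b t * \sum_(v in L) x v ^+ 2 <= k * eigen_bound R a b t * #|S|%:R.
  by rewrite ler_wpM2l // mulr_ge0 // eigen_bound_ge0.
move=> h1 h2; have := le_trans h2 h1.
by rewrite lerBlDl [X in _ -> _ <= X]mulrDr [k * (eigen_bound R a b t * _)]mulrA.
Qed.

End RealForm.

(** * The Johnson graph as a distance relation on supports *)

Section JohnsonGraph.
Variables (n r s : nat).
Hypothesis rn : (r < n)%N.
Hypothesis sr : (s < r)%N.
Implicit Types v w : johnson_vertex n r.

Definition vertex_support v : {set 'I_n} := [set i | val v i]%SET.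

Lemma vertex_support_inj : injective vertex_support.
Proof.
move=> v w /setP H; apply/val_inj/ffunP => i.
by have := H i; rewrite !inE.
Qed.

Lemma card_vertex_support v : #|vertex_support v| = r.
Proof.
have /eqP vr := valP v; transitivity (\sum_(i < n) val v i)%N => //.
rewrite -sum1_card big_mkcond /=.
by apply: eq_bigr => i _; rewrite inE /=; case: (val v i).
Qed.

Lemma vertex_support_layer v : vertex_support v \in layer [set: 'I_n]%SET r.
Proof. by rewrite inE finset.subsetT card_vertex_support eqxx. Qed.

Lemma vertex_support_image :
  (vertex_support @: [set: johnson_vertex n r])%SET = layer [set: 'I_n]%SET r.
Proof.
apply/eqP; rewrite finset.eqEsubset; apply/andP; split.
  by apply/fintype.subsetP => _ /finset.imsetP[v _ ->]; exact: vertex_support_layer.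
apply/fintype.subsetP => u; rewrite inE => /andP[_ /eqP ur].
have fr : (\sum_(i < n) [ffun i => i \in u] i)%N == r.
  rewrite -ur -sum1_card [X in _ == X]big_mkcond /=; apply/eqP.
  by apply: eq_bigr => i _; rewrite ffunE; case: (i \in u).
apply/finset.imsetP; exists (exist _ [ffun i => i \in u] fr) => //.
by apply/setP => i; rewrite inE ffunE.
Qed.

Lemma inner_productE v w :
  inner_product v w = #|vertex_support v :&: vertex_support w|%SET.
Proof.
rewrite /inner_product -sum1_card [RHS]big_mkcond /=; apply: eq_bigr => i _.
by rewrite !inE; case: (val v i); case: (val w i).
Qed.

(** Supports have [r] points, so meeting in [s] points means distance [r - s]. Equal vertices have
    inner product [r > s], so the condition forces [v != w]. *)
Lemma linked_johnson v w : linked (johnson_edges n r s) v w =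
  (#|vertex_support v :\: vertex_support w|%SET == (r - s)%N).
Proof.
have := cardsID (vertex_support w) (vertex_support v).
rewrite card_vertex_support -inner_productE => e.
have vw_e : (inner_product v w == s) =
    (#|vertex_support v :\: vertex_support w|%SET == (r - s)%N).
  by apply/eqP/eqP; lia.
rewrite -vw_e /linked inE; apply/existsP/idP => [[v' /existsP[w' /and3P[_ ip /eqP vwE]]]|ip].
  have symip : inner_product w' v' == s by rewrite inner_productE finset.setIC -inner_productE.
  have := finset.set21 v w; have := finset.set22 v w; rewrite vwE !inE.
  have := finset.set21 v' w'; have := finset.set22 v' w'; rewrite -vwE !inE.
  by do 4![case/orP => /eqP ?]; subst.
exists v; apply/existsP; exists w; rewrite ip eqxx !andbT.
apply: contraTneq ip => <-.
by rewrite inner_productE finset.setIid card_vertex_support; apply/negP => /eqP; lia.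
Qed.

Lemma johnson_edges_card2 e : e \in johnson_edges n r s -> #|e| = 2.
Proof.
rewrite inE => /existsP[v /existsP[w /and3P[vw _ /eqP->]]].
by rewrite cards2 vw.
Qed.

Lemma card_johnson_vertex : #|johnson_vertex n r| = 'C(n, r).
Proof.
rewrite -cardsT -(card_imset _ vertex_support_inj) vertex_support_image.
have := card_draws 'I_n r; rewrite card_ord => <-.
by apply: eq_card => u; rewrite !inE finset.subsetT.
Qed.

Lemma johnson_edges_degree v :
  degree (johnson_edges n r s) v = johnson_degree r (n - r) (r - s).
Proof.
rewrite degreeE; last exact: johnson_edges_card2.
have ab : #|[set: 'I_n]%SET| = (r + (n - r))%N.
  by rewrite cardsT card_ord subnKC // ltnW.
rewrite -(card_layer_dist (r - s)%N ab (vertex_support_layer v)).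
rewrite -sum1_card -vertex_support_image.
under [RHS]eq_bigl do rewrite inE.
rewrite big_mkcondr big_imset /=; last by move=> x y _ _; exact: vertex_support_inj.
rewrite [RHS](eq_bigl xpredT) => [|w]; last by rewrite inE.
by apply: eq_bigr => w _; rewrite linked_johnson; case: eqP.
Qed.

Lemma johnson_expansion (R : realType) (S : {set johnson_vertex n r}) :
  2 * (edges_inside (johnson_edges n r s) S)%:R <=
  (johnson_degree r (n - r) (r - s))%:R *
   (#|S|%:R ^+ 2 / #|johnson_vertex n r|%:R + eigen_bound R r (n - r) (r - s) * #|S|%:R).
Proof.
have ab : #|'I_n| = (r + (n - r))%N by rewrite card_ord subnKC // ltnW.
have SL : (vertex_support @: S \subset layer [set: 'I_n] r)%SET.
  by rewrite -vertex_support_image finset.imsetS // finset.subsetT.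
have := layer_edge_bound R (r - s)%N ab SL.
rewrite (card_imset _ vertex_support_inj) -vertex_support_image.
rewrite (card_imset _ vertex_support_inj) cardsT.
congr (_ <= _); rewrite -natrM edges_inside_double; last exact: johnson_edges_card2.
rewrite natr_sum big_imset /=; last by move=> x y _ _; exact: vertex_support_inj.
apply: eq_bigr => v _.
rewrite natr_sum big_imset /=; last by move=> x y _ _; exact: vertex_support_inj.
by apply: eq_bigr => w _; rewrite linked_johnson.
Qed.

End JohnsonGraph.

(** * Concentration of edge counts *)

Section Concentration.
Variable R : realType.

(** From [exp(-t) >= 1 - t] one gets [exp t <= 1/(1-t)], and [(1 + t + 2 t^2)(1 - t) = 1 + t^2 (1 -
    2t) >= 1]. *)
Lemma expR_le_quadratic (t : R) : t <= 1 / 2 -> expR t <= 1 + t + 2 * t ^+ 2.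
Proof.
move=> t2; have h : 0 < 1 - t by lra.
have : expR t * (1 - t) <= 1.
  rewrite -[1 in X in _ <= X](expR0 R) -(subrr t) expRD ler_wpM2l ?expR_ge0 //.
  by have := expR_ge1Dx (- t).
rewrite -ler_pdivlMr // => /le_trans; apply; rewrite ler_pdivrMr //.
have : 0 <= t ^+ 2 * (1 - 2 * t) by rewrite mulr_ge0 ?sqr_ge0 //; lra.
lra.
Qed.

Lemma sum_subset_exp (I : finType) (S : {set I}) (y : R) :
  \sum_(J : {set I} | J \subset S) y ^+ #|J| = (1 + y) ^+ #|S|.
Proof.
rewrite exprDn (partition_big (fun J : {set I} => inord #|J| : 'I_#|S|.+1) predT) //=.
apply: eq_bigr => i _; rewrite expr1n mul1r -(cards_draws S) -sumr_const.
apply: eq_big => [J|J /andP[JS /eqP <-]]; last first.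
  by rewrite inordK // ltnS subset_leq_card.
rewrite inE; apply: andb_id2l => JS.
by rewrite -val_eqE /= inordK // ltnS subset_leq_card.
Qed.

Variables (I : finType) (E : {set I}) (mu : {set I} -> R) (p : R).
Hypothesis mu0 : forall F, 0 <= mu F.
Hypothesis p0 : 0 <= p.
Hypothesis p1 : p <= 1.
Hypothesis mu_incl : forall J : {set I}, J \subset E ->
  \sum_(F : {set I} | J \subset F) mu F = p ^+ #|J|.

(* Expanding [(1 + y) ^+ #|F :&: S|] over the subsets of [F :&: S] leaves only
   probabilities of inclusions, given by the product rule. *)
Lemma sum_mu_exp (S : {set I}) (y : R) : S \subset E ->
  \sum_(F : {set I}) mu F * (1 + y) ^+ #|F :&: S| = (1 + p * y) ^+ #|S|.
Proof.
move=> SE; rewrite -sum_subset_exp.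
under eq_bigr do rewrite -sum_subset_exp mulr_sumr.
under eq_bigr do under eq_bigl do rewrite finset.subsetI.
rewrite (exchange_big_dep (fun J : {set I} => J \subset S)) /=; last by move=> F J _ /andP[].
apply: eq_bigr => J JS; rewrite exprMn -(mu_incl (fintype.subset_trans JS SE)) mulr_suml.
by apply: eq_bigl => F; rewrite JS andbT.
Qed.

(** Each factor [1 + p (exp t - 1)] is at most [exp(p (t + 2 t^2))], and centring removes the linear
    term. *)
Lemma exp_moment (S : {set I}) (t : R) : S \subset E -> t <= 1 / 2 ->
  \sum_(F : {set I}) mu F * expR (t * (#|F :&: S|%:R - p * #|S|%:R)) <=
  expR (2 * t ^+ 2 * p * #|S|%:R).
Proof.
move=> SE t2.
have -> : \sum_(F : {set I}) mu F * expR (t * (#|F :&: S|%:R - p * #|S|%:R)) =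
    expR (- (t * p * #|S|%:R)) * (1 + p * (expR t - 1)) ^+ #|S|.
  rewrite -sum_mu_exp // mulr_sumr; apply: eq_bigr => F _.
  rewrite [1 + (_ - _)]addrC subrK -expRM_natr mulrCA -expRD.
  by congr (_ * expR _); ring.
have -> : 2 * t ^+ 2 * p * #|S|%:R =
  - (t * p * #|S|%:R) + (t + 2 * t ^+ 2) * p * #|S|%:R by ring.
rewrite [leRHS]expRD ler_pM2l ?expR_gt0 // expRM_natr.
have h0 : 0 <= 1 + p * (expR t - 1).
  have : 0 <= p * expR t by rewrite mulr_ge0 ?expR_ge0.
  by move: p1; lra.
rewrite lerXn2r ?nnegrE ?expR_ge0 //.
apply: le_trans (expR_ge1Dx _); rewrite lerD2l mulrC ler_wpM2r //.
by have := expR_le_quadratic t2; lra.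
Qed.

(** Chernoff bound with the exponents [t] and [-t]. The choice [t = eps/4] minimises
    [2 t^2 - eps t], with value [- eps^2 / 8], and [eps <= 2] keeps [t <= 1/2]. *)
Lemma two_sided_tail (S : {set I}) (eps : R) : S \subset E ->
    0 < eps -> eps <= 2 ->
  \sum_(F : {set I} |
      eps * p * #|E|%:R < `|#|F :&: S|%:R - p * #|S|%:R|) mu F <=
  2 * expR (- (eps ^+ 2 / 8 * (p * #|E|%:R))).
Proof.
move=> SE eps0 eps2; pose t := eps / 4; pose c := eps * p * #|E|%:R.
have t0 : 0 < t by rewrite divr_gt0.
have c0 : 0 <= c by rewrite !mulr_ge0 // ltW.
pose z (F : {set I}) : R := #|F :&: S|%:R - p * #|S|%:R.
have ind F : c < `|z F| -> mu F <=
    expR (- (t * c)) * (mu F * expR (t * z F) + mu F * expR (- t * z F)).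
  move=> cz; rewrite -mulrDr mulrCA -[X in X <= _]mulr1 ler_wpM2l //.
  have [h|h] := leP 0 (z F).
    rewrite (ger0_norm h) in cz.
    apply: le_trans (_ : expR (- (t * c)) * expR (t * z F) <= _); last first.
      by rewrite ler_pM2l ?expR_gt0 // lerDl expR_ge0.
    by rewrite -expRD -[X in X <= _](expR0 R) ler_expR addrC -mulrBr mulr_ge0 ?ltW // subr_gt0.
  rewrite (ltr0_norm h) in cz.
  apply: le_trans (_ : expR (- (t * c)) * expR (- t * z F) <= _); last first.
    by rewrite ler_pM2l ?expR_gt0 // lerDr expR_ge0.
  rewrite -expRD -[X in X <= _](expR0 R) ler_expR addrC mulNr -mulrN -mulrBr.
  by rewrite mulr_ge0 ?ltW // subr_gt0.
have half : t <= 1 / 2 by rewrite /t; lra.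
have halfN : - t <= 1 / 2 by move: t0; lra.
rewrite (le_trans (ler_sum _ ind)) // -mulr_sumr.
have -> : 2 * expR (- (eps ^+ 2 / 8 * (p * #|E|%:R))) = expR (- (t * c)) *
    (expR (2 * t ^+ 2 * (p * #|E|%:R)) + expR (2 * t ^+ 2 * (p * #|E|%:R))).
  rewrite -[X in _ = _ * X]mulr2n -[X in _ = _ * X]mulr_natl [RHS]mulrCA -expRD.
  congr (_ * expR _).
  by rewrite /t /c; field.
rewrite ler_pM2l ?expR_gt0 // big_split /=.
have mono (t' : R) : expR (2 * t' ^+ 2 * p * #|S|%:R) <= expR (2 * t' ^+ 2 * (p * #|E|%:R)).
  have q0 : 0 <= 2 * t' ^+ 2 := mulr_ge0 (ler0n _ 2) (sqr_ge0 t').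
  by rewrite ler_expR -mulrA ler_wpM2l // ler_wpM2l // ler_nat subset_leq_card.
have tot (t' : R) : t' <= 1 / 2 -> \sum_(F : {set I} | c < `|z F|) mu F * expR (t' * z F) <=
    expR (2 * t' ^+ 2 * (p * #|E|%:R)).
  move=> h; rewrite (le_trans _ (mono t')) // (le_trans _ (exp_moment SE h)) //.
  rewrite [X in _ <= X](bigID (fun F => c < `|z F|)) /= lerDl.
  by apply: sumr_ge0 => F _; rewrite mulr_ge0 ?expR_ge0.
by rewrite lerD ?tot // -sqrrN tot.
Qed.

Lemma union_tail (J : finType) (S : J -> {set I}) (eps : R) :
    (forall j, S j \subset E) -> 0 < eps -> eps <= 2 ->
  \sum_(F : {set I} | [exists j,
      eps * p * #|E|%:R < `|#|F :&: S j|%:R - p * #|S j|%:R|]) mu F <=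
  #|J|%:R * (2 * expR (- (eps ^+ 2 / 8 * (p * #|E|%:R)))).
Proof.
move=> SE eps0 eps2.
have -> (x : R) : #|J|%:R * x = \sum_(j : J) x by rewrite sumr_const mulr_natl.
rewrite (le_trans _ (ler_sum _ (fun j _ => two_sided_tail (SE j) eps0 eps2))) //.
under [X in _ <= X]eq_bigr do rewrite big_mkcond.
rewrite exchange_big /= big_mkcond; apply: ler_sum => F _.
case: ifP => [/existsP[j bj]|_]; last by apply: sumr_ge0 => j _; case: ifP.
rewrite (bigD1 j) //= bj lerDl; apply: sumr_ge0 => i _; by case: ifP.
Qed.

End Concentration.

(** * The law of the random subgraph *)

Section RandomSubgraphLaw.
Variables (d : measure_display) (T : measurableType d) (R : realType).
Variables (P : probability T R) (V : finType) (E : {set {set V}}) (p : R).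
Variable G : T -> {set {set V}}.
Hypothesis GE : random_subgraph P E p G.
Local Open Scope classical_set_scope.

(** For [F] inside [E] this event is a finite intersection of edge events and their complements. *)
Lemma measurable_subgraph_eq F : measurable [set w | G w = F].
Proof.
have [sub _ [mG _]] := GE.
have [FE|FE] := boolP (F \subset E); last first.
  rewrite (_ : [set w | _] = set0) //; apply/seteqP; split=> // w /= GF.
  by move: FE; rewrite -GF sub.
rewrite (_ : [set w | _] = \bigcap_(e in [set` E])
    (if e \in F then [set w | e \in G w] else ~` [set w | e \in G w])).
  apply: fin_bigcap_measurable => // e /= eE; case: ifP => _; first exact: mG.
  by apply: measurableC; exact: mG.
apply/seteqP; split=> [w /= <- e /= eE|w /= H]; first by case: ifPn => //= /negP.
apply/finset.setP => e; have [eE|eE] := boolP (e \in E).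
  by have := H e eE; case: (e \in F) => //= /negP/negbTE.
rewrite (contraNF (fintype.subsetP (sub w) e) eE).
by rewrite (contraNF (fintype.subsetP FE e) eE).
Qed.

Let subgraph_preimage (D : pred {set {set V}}) :
  [set w | D (G w)] = \bigcup_(F in [set` D]) [set w | G w = F].
Proof.
apply/seteqP; split=> [w Dw|w [F DF GwF]]; first by exists (G w).
by rewrite /= GwF.
Qed.

Lemma measurable_subgraph (D : pred {set {set V}}) : measurable [set w | D (G w)].
Proof.
rewrite subgraph_preimage; apply: fin_bigcup_measurable => // F _.
exact: measurable_subgraph_eq.
Qed.

Definition subgraph_mass F : R := fine (P [set w | G w = F]).

Lemma subgraph_mass_ge0 F : 0 <= subgraph_mass F.
Proof. exact: fine_ge0. Qed.

Lemma probability_subgraph (D : pred {set {set V}}) :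
  P [set w | D (G w)] = (\sum_(F | D F) subgraph_mass F)%:E.
Proof.
rewrite subgraph_preimage measure_fin_bigcup //; last 2 first.
- by move=> F F' _ _ [w [/= <- <-]].
- by move=> F _; exact: measurable_subgraph_eq.
rewrite -sumEFin (bigfs _ (index_enum_uniq _)) //; last first.
  by move=> F _; rewrite mem_index_enum.
apply: eq_fsbigr => F _; rewrite /subgraph_mass fineK //.
exact: fin_num_measure (measurable_subgraph_eq F).
Qed.

(** Independence enters only here; the result is the hypothesis [mu_incl] of the concentration
    bounds. *)
Lemma subgraph_mass_incl (J : {set {set V}}) : J \subset E ->
  \sum_(F : {set {set V}} | J \subset F) subgraph_mass F = p ^+ #|J|.
Proof.
have [sub pE [mG ind]] := GE.
move=> JE; apply: EFin_inj; rewrite -probability_subgraph.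
rewrite (_ : [set w | _] = \bigcap_(e in [set` J]) [set w | e \in G w]); last first.
  apply/seteqP; split=> [w /= /fintype.subsetP H e /= /H //|w H].
  by apply/fintype.subsetP => e; exact: H.
rewrite ind // (eq_bigr (fun=> p%:E)) => [|e eJ]; last first.
  by rewrite pE // (fintype.subsetP JE).
by rewrite prodEFin prodr_const.
Qed.

End RandomSubgraphLaw.

(** * Limits superior and almost sure events *)

Section Limits.
Local Open Scope classical_set_scope.
Local Open Scope ring_scope.
Variable R : realType.

Lemma limn_esup_le_approx (u v : nat -> R) :
  (forall e, 0 < e -> \forall n \near \oo, u n <= v n + e) ->
  (limn_esup (fun n => (u n)%:E) <= limn_esup (fun n => (v n)%:E))%E.
Proof.
move=> uv.
have infE (w : (\bar R)^nat) : limn_esup w = ereal_inf (range (esups w)).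
  by rewrite limn_esup_lim; apply/cvg_lim => //; exact: cvg_esups_inf.
rewrite !infE.
apply/lee_addgt0Pr => e e0; rewrite -leeBlDr //.
apply: le_ereal_inf_tmp => _ [m _ <-]; rewrite leeBlDr //.
have [N _ HN] := uv e e0.
apply: (@le_trans _ _ (esups (fun n => (u n)%:E) (maxn m N))).
  by apply: ereal_inf_lbound; exists (maxn m N).
apply: ge_ereal_sup => _ [k /= km <-].
apply: (@le_trans _ _ ((v k)%:E + e%:E)%E).
  by rewrite -EFinD lee_fin HN //= (leq_trans _ km) // leq_maxr.
rewrite leeD2r //; apply: ereal_sup_ubound; exists k => //=.
by rewrite (leq_trans _ km) // leq_maxl.
Qed.

Variables (d : measure_display) (T : measurableType d) (P : probability T R).

Lemma ae_eventually_not (c : R) (B : nat -> set T) : 0 <= c ->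
    (forall n, measurable (B n)) ->
    (forall n, P (B n) <= (c / (2 ^ n.+1)%:R)%:E)%E ->
  {ae P, forall w, exists N, forall n, (N <= n)%N -> ~ B n w}.
Proof.
move=> c0 mB PB.
have fin : (\sum_(n <oo) P (B n) < +oo)%E.
  (* [epsilon_trick] on the zero sequence bounds the geometric series by [c]. *)
  have h : (\sum_(0 <= n <oo) ((fun=> 0%E) n + (c / (2 ^ n.+1)%:R)%:E) <= 
      \sum_(0 <= n <oo) ((fun=> 0%E) n : \bar R) + c%:E)%E by apply: epsilon_trick.
  apply: (@le_lt_trans _ _ (c%:E)); last exact: ltry.
  apply: le_trans (_ : _ <= \sum_(0 <= n <oo) (0 + (c / (2 ^ n.+1)%:R)%:E))%E _.
    by apply: lee_nneseries => // n _; rewrite add0e.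
  by rewrite (le_trans h) // eseries0 ?add0e.
exists (lim_sup_set B); split.
- apply: bigcap_measurable => // k _; exact: bigcup_measurable.
- exact: lim_sup_set_cvg0.
- move=> w /= H n _; apply: contrapT => HB; apply: H; exists n => k nk Bk.
  by apply: HB; exists k.
Qed.

End Limits.

(** * Probability that some edge count deviates *)

Section BadEvent.
Local Open Scope classical_set_scope.
Local Open Scope ring_scope.
Variables (R : realType) (V : finType) (E : {set {set V}}) (p eps : R).

Definition edges_in (A : {set V}) : {set {set V}} := [set e in E | e \subset A]%SET.

Definition deviates (F : {set {set V}}) : bool :=
  [exists A : {set V}, eps * p * #|E|%:R <
     `|#|F :&: edges_in A|%SET%:R - p * #|edges_in A|%:R|].

Lemma deviatesN (F : {set {set V}}) (S : {set V}) : F \subset E -> ~~ deviates F ->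
  `|(edges_inside F S)%:R - p * (edges_inside E S)%:R| <= eps * p * #|E|%:R.
Proof.
move=> FE; rewrite negb_exists => /forallP/(_ S); rewrite -leNgt.
congr (`|_%:R - _| <= _); apply: eq_card => e; rewrite !inE.
by case eF : (e \in F) => //=; rewrite (fintype.subsetP FE).
Qed.

Variables (d : measure_display) (T : measurableType d) (P : probability T R).
Variable G : T -> {set {set V}}.
Hypothesis GE : random_subgraph P E p G.
Hypothesis p01 : 0 <= p <= 1.
Hypothesis eps0 : 0 < eps.
Hypothesis eps2 : eps <= 2.

(** Since [#|E| = k N / 2], the constant 32 makes the tail exponent at least [2 N]. The union over
    [2^N] vertex sets costs at most [exp N], and what remains is at most [2 / 2^N], summable in [n]
    because [n <= N]. *)
Lemma probability_deviates n k : (n <= #|V|)%N -> (k * #|V| = 2 * #|E|)%N ->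
    32 <= eps ^+ 2 * (p * k%:R) ->
  (P [set w | deviates (G w)] <= (4 / (2 ^ n.+1)%:R)%:E)%E.
Proof.
move=> nV kV large; have /andP[p0 p1] := p01.
rewrite (probability_subgraph GE) lee_fin.
have SE A : edges_in A \subset E.
  by apply/fintype.subsetP => e; rewrite inE => /andP[].
apply: le_trans (union_tail (subgraph_mass_ge0 P G) p0 p1
  (subgraph_mass_incl GE) SE eps0 eps2) _.
have -> : #|{: {set V}}| = (2 ^ #|V|)%N.
  have := card_powerset [set: V]%SET; rewrite finset.powersetT !cardsT => <-.
  by apply: eq_card => A; rewrite inE.
set N := #|V| in nV kV *.
have e1 : 2 <= expR 1 :> R by have := expR_ge1Dx (1 : R); lra.
have twoN : (2 ^ N)%:R <= expR N%:R :> R.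
  by rewrite natrX -[N%:R]mul1r expRM_natr lerXn2r ?nnegrE ?expR_ge0.
have pE : eps ^+ 2 / 8 * (p * #|E|%:R) = eps ^+ 2 * (p * k%:R) * N%:R / 16.
  have : k%:R * N%:R = 2 * #|E|%:R :> R by rewrite -!natrM kV.
  by move=> h; rewrite -[X in _ = X / 16]mulrA -[X in _ * X / 16]mulrA h; field.
have small : expR (- (eps ^+ 2 / 8 * (p * #|E|%:R))) <= expR (- N%:R) * expR (- N%:R).
  rewrite -expRD ler_expR pE.
  have : 32 * N%:R <= eps ^+ 2 * (p * k%:R) * N%:R by rewrite ler_wpM2r.
  lra.
apply: (@le_trans _ _ ((2 ^ N)%:R * (2 * (expR (- N%:R) * expR (- N%:R))))).
  by rewrite ler_wpM2l // ler_wpM2l.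
have -> : (2 ^ N)%:R * (2 * (expR (- N%:R) * expR (- N%:R))) =
  2 * (((2 ^ N)%:R / expR N%:R) / expR N%:R) :> R by rewrite expRN; ring.
apply: (@le_trans _ _ (2 * (2 ^ N)%:R^-1)).
  rewrite ler_wpM2l // ler_pdivrMr ?expR_gt0 //.
  apply: (@le_trans _ _ 1); first by rewrite ler_pdivrMr ?expR_gt0 // mul1r.
  by rewrite ler_pdivlMl ?mulr1 // ltr0n expn_gt0.
rewrite expnS natrM invfM mulrA (_ : 4 / 2 = 2) //; last by field.
rewrite ler_wpM2l // lef_pV2 ?posrE ?ltr0n ?expn_gt0 // ler_nat leq_exp2l //.
Qed.

End BadEvent.

(** * Estimates for the Johnson parameters and conclusion *)

Lemma leq_bin n r : (0 < r < n)%N -> (n <= 'C(n, r))%N.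
Proof.
elim: n r => [|n IH] [|r] //; rewrite ltnS => /andP[_ rn].
rewrite binS; case: r rn => [|r] rn; first by rewrite bin0 bin1 addn1.
have [rn'|rn'] := ltnP r.+2 n; last first.
  by rewrite (_ : n = r.+2) ?binn ?binSn // ?add1n //; lia.
have := IH r.+2 rn'; have := IH r.+1 (ltnW rn'); lia.
Qed.

Lemma sqrtr_nat_le (R : realType) (k : nat) : Num.sqrt k%:R <= k%:R :> R.
Proof.
case: k => [|k]; first by rewrite sqrtr0.
rewrite -[X in _ <= X]sqr_sqrtr // expr2 ler_peMl ?sqrtr_ge0 //.
by rewrite -[X in X <= _]sqrtr1 ler_sqrt // ler1n.
Qed.

Lemma eigen_bound_johnson (R : realType) (n r s : nat) : (s < r < n)%N ->
  eigen_bound R r (n - r) (r - s) =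
  `|(s * n)%:R - (r ^ 2)%:R| / (r * (n - r))%:R + 16 / n%:R.
Proof.
move=> /andP[sr rn]; rewrite /eigen_bound -natrD subnKC ?(ltnW rn) // [(r * (n - r))%:R]natrM.
congr (_ / _ + _); rewrite distrC natrX [(s * n)%:R]natrM !natrB ?(ltnW sr) ?(ltnW rn) //.
by congr `|_|; ring.
Qed.

(** As [0 <= t (a + b) <= 2 a b], the main term is at most 1; the slack is at most 16. *)
Lemma eigen_bound_le (R : realType) (a b t : nat) : (0 < a)%N -> (0 < b)%N ->
  (t <= a)%N -> (t <= b)%N -> (eigen_bound R a b t <= 17).
Proof.
move=> a0 b0 ta tb.
have a0' : 0 < a%:R :> R by rewrite ltr0n.
have b0' : 0 < b%:R :> R by rewrite ltr0n.
have ta' : t%:R <= a%:R :> R by rewrite ler_nat.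
have tb' : t%:R <= b%:R :> R by rewrite ler_nat.
have h1 : `|t%:R * (a%:R + b%:R) - a%:R * b%:R| / (a%:R * b%:R) <= 1 :> R.
  rewrite ler_pdivrMr ?mulr_gt0 // mul1r ler_norml.
  have : 0 <= t%:R * (a%:R + b%:R) :> R by rewrite mulr_ge0.
  have : t%:R * a%:R <= b%:R * a%:R :> R by rewrite ler_wpM2r.
  have : t%:R * b%:R <= a%:R * b%:R :> R by rewrite ler_wpM2r.
  by move=> *; apply/andP; split; lra.
have h2 : 16 / (a%:R + b%:R) <= 16 :> R.
  by rewrite ler_pdivrMr ?addr_gt0 // ler_peMr // -natrD ler1n addn_gt0 a0.
rewrite /eigen_bound; lra.
Qed.

Lemma modularity_johnson_subgraph (R : realType) (n r s m : nat) (p eps : R)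
    (F : {set {set johnson_vertex n r}}) :
    (s < r < n)%N -> (0 < #|johnson_edges n r s|)%N -> F \subset johnson_edges n r s ->
    0 < p -> 0 < eps -> eps <= 1 / 2 -> ~~ deviates (johnson_edges n r s) p eps F ->
  modularity R F <= `|(s * n)%:R - (r ^ 2)%:R| / (r * (n - r))%:R +
    (16 / n%:R + 17 / m.+1%:R + 2 * (2 * m.+2%:R + 41) * eps).
Proof.
move=> srn E0 FE p0 eps0 eps2 dev; have /andP[sr rn] := srn.
have E2 := @johnson_edges_card2 n r s.
have kV := regular_card E2 (johnson_edges_degree rn sr).
(* An edge exists, so the degree is positive, which forces [r - s <= n - r]. *)
have k0 : (0 < johnson_degree r (n - r) (r - s))%N.
  by move: E0 kV; case: johnson_degree => //; lia.
have tb : (r - s <= n - r)%N.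
  by move: k0; rewrite muln_gt0 !bin_gt0 => /andP[].
have rho0 := eigen_bound_ge0 R r (n - r) (r - s).
have rho17 : eigen_bound R r (n - r) (r - s) <= 17.
  by apply: eigen_bound_le => //; lia.
have := modularity_perturbed E2 FE (johnson_edges_degree rn sr) E0
  (johnson_expansion rn sr R) p0 eps0 eps2 rho0 rho17
  (fun S => deviatesN S FE dev) m.
move/le_trans; apply.
have rhoE := eigen_bound_johnson R srn.
set rho := eigen_bound _ _ _ _ in rho0 rho17 rhoE *.
set q : R := m.+1%:R^-1; set y := 2 * m.+2%:R + 41.
have q0 : 0 <= q by rewrite invr_ge0.
have q1 : q <= 1 by rewrite invf_le1 ?ler1n ?ltr0n.
have y0 : 0 <= y by rewrite addr_ge0.
have h1 : 0 <= q * (17 - rho) by rewrite mulr_ge0 // subr_ge0.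
have h2 : 0 <= (1 - q) * (y * eps).
  by rewrite mulr_ge0 ?subr_ge0 // mulr_ge0 // ltW.
lra.
Qed.

Theorem theorem3p9 (R : realType) (d : measure_display) (T : measurableType d)
    (P : probability T R) (r s : nat -> nat) (p : nat -> R)
    (G : forall n : nat, T -> {set {set johnson_vertex n (r n)}})
    (hrs : forall n : nat, (2 <= n)%N -> (s n < r n < n)%N)
    (hedge : forall n : nat, (2 <= n)%N ->
       (0 < #|johnson_edges n (r n) (s n)|)%N)
    (hineq : forall n : nat, (2 <= n)%N ->
       (r n * (n - r n) <= (r n - s n) * (n - 1))%N)
    (hp01 : forall n : nat, (2 <= n)%N -> 0 <= p n <= 1)
    (hp : little_omega p (fun n : nat =>
       1 / Num.sqrt ('C(n - r n, r n - s n) * 'C(r n, s n))%:R))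
    (hG : forall n : nat, (2 <= n)%N ->
       random_subgraph P (johnson_edges n (r n) (s n)) (p n) (G n)) :
  {ae P, forall w : T,
    (limn_esup (fun n : nat => (modularity R (G n w))%:E) <=
     limn_esup (fun n : nat =>
       (`|(s n * n)%:R - (r n ^ 2)%:R| / (r n * (n - r n))%:R)%:E))%E}.
Proof.
pose k n := johnson_degree (r n) (n - r n) (r n - s n).
(* Up to symmetry of a binomial coefficient, [k n] is the number under the root, and a natural
   number is at least its square root. *)
have large A : exists2 N, (2 <= N)%N & forall n, (N <= n)%N -> A <= p n * (k n)%:R.
  have /cvgryPge/(_ A)[N _ HN] := hp.
  exists (maxn 2 N); first exact: leq_maxl.
  move=> n; rewrite geq_max => /andP[n2 Nn]; have /andP[p0 _] := hp01 n n2.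
  have := HN n Nn; rewrite /= invf_div divr1 => /le_trans; apply.
  rewrite ler_wpM2l // (le_trans (sqrtr_nat_le R _)) // ler_nat.
  rewrite /k /johnson_degree mulnC bin_sub //.
  by have /andP[/ltnW] := hrs n n2.
pose eps j : R := j.+2%:R^-1.
have eps0 j : 0 < eps j by rewrite invr_gt0.
have eps2 j : eps j <= 1 / 2 by rewrite mul1r lef_pV2 ?posrE // ler_nat.
have good j : {ae P, forall w, exists N, forall n, (N <= n)%N ->
    ~~ deviates (johnson_edges n (r n) (s n)) (p n) (eps j) (G n w)}.
  have [N N2 HN] := large (32 / eps j ^+ 2).
  (* The finitely many early events are made empty, so that measurability and the summable bound
     hold for every [n]. *)
  pose B n := if (N <= n)%N then
    [set w | deviates (johnson_edges n (r n) (s n)) (p n) (eps j) (G n w)]%classic else set0.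
  have mB n : measurable (B n).
    rewrite /B; case: ifP => // Nn.
    exact: (measurable_subgraph (hG n (leq_trans N2 Nn)) (deviates _ (p n) (eps j))).
  have PB n : (P (B n) <= (4 / (2 ^ n.+1)%:R)%:E)%E.
    rewrite /B; case: ifP => Nn; last by rewrite measure0 lee_fin divr_ge0.
    have n2 := leq_trans N2 Nn; have /andP[sr rn] := hrs n n2.
    have e2 : eps j <= 2 by apply: le_trans (eps2 j) _; lra.
    apply: (@probability_deviates _ _ _ _ _ _ _ _ _ (hG n n2) (hp01 n n2) (eps0 j) e2 n (k n)).
    - by rewrite card_johnson_vertex leq_bin // rn (leq_ltn_trans _ sr).
    - exact: (regular_card (@johnson_edges_card2 _ _ _) (johnson_edges_degree rn sr)).
    - by rewrite mulrC -ler_pdivrMr ?exprn_gt0 // HN.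
  apply: filterS (ae_eventually_not _ mB PB) => // w [N' H].
  exists (maxn N N') => n; rewrite geq_max => /andP[Nn N'n].
  by apply/negP => dev; apply: (H n N'n); rewrite /B Nn.
(* Only countably many precisions [eps j] occur, so one null set serves all [e]. *)
have /ae_foralln := good; apply: filterS => w Hw.
apply: limn_esup_le_approx => e e0.
have inv_small (c : R) : 0 <= c -> exists m : nat,
    forall m', (m <= m')%N -> c / m'.+1%:R <= e / 3.
  move=> c0; exists (Num.bound (3 * c / e)) => m' mm'.
  have h : 3 * c / e < m'.+1%:R.
    apply: lt_le_trans (archi_boundP _) _; first by rewrite divr_ge0 ?mulr_ge0 // ltW.
    by rewrite ler_nat leqW.
  rewrite ler_pdivrMr // mulrAC ler_pdivlMr // mulrC.
  by move: h; rewrite ltr_pdivrMr // => /ltW; rewrite [m'.+1%:R * e]mulrC.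
(* The error is split into thirds: first the number of classes [m], then the precision [eps j]
   depending on [m], finally [n]. *)
have [m /(_ m (leqnn m)) Hm] := inv_small 17 (ler0n _ _).
have y0 : 0 <= 2 * (2 * m.+2%:R + 41) :> R by rewrite mulr_ge0 ?addr_ge0.
have [j /(_ j.+1 (leqnSn j)) Hj] := inv_small _ y0.
have [N1 HN1] := inv_small 16 (ler0n _ _).
have [N2 N22 HN2] := large 1.
have [N3 HN3] := Hw j.
exists (maxn N1.+1 (maxn N2 N3)) => // n /=; rewrite !geq_max => /and3P[n1 n2 n3].
have nn2 := leq_trans N22 n2; have [sub _ _] := hG n nn2.
have p0 : 0 < p n.
  have /andP[p_ge0 _] := hp01 n nn2; rewrite lt_neqAle p_ge0 andbT eq_sym.
  by apply/eqP => p0; have := HN2 n n2; rewrite p0 mul0r; lra.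
have := modularity_johnson_subgraph m (hrs n nn2) (hedge n nn2) (sub w) p0
  (eps0 j) (eps2 j) (HN3 n n3).
move/le_trans; apply; rewrite lerD2l.
have Hn : 16 / n%:R <= e / 3.
  by case: n n1 {n2 n3 nn2 sub p0} => // n n1; exact: HN1.
have Hj' : 2 * (2 * m.+2%:R + 41) * eps j <= e / 3 := Hj.
move: Hn Hm Hj'; move: (16 / n%:R) (17 / m.+1%:R) (_ * eps j) => x y z; lra.
Qed.
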